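(* Let $k,\ell\geqslant 2$ be arbitrary integers. Then the $k$-free shift induced by a real quadratic field can never be topologically conjugate to the $\ell$-free shift induced by an imaginary quadratic field.
   Context: For a quadratic field $K=\mathbb{Q}(\sqrt{d})$ with $d\in\mathbb{Z}\setminus\{0,1\}$ square-free, the ring of integers is $\mathcal{O}=\mathbb{Z}\oplus\mathbb{Z}\delta$ with $\delta=\sqrt{d}$ if $d\equiv 2,3\bmod 4$ and $\delta=\frac{1+\sqrt{d}}{2}$ if $d\equiv 1\bmod 4$. For $k\geqslant 2$, an element $0\neq x\in\mathcal{O}$ is $k$-free if $v_{\mathfrak{p}}(x)<k$ for all prime ideals $\mathfrak{p}$ of $\mathcal{O}$, where $v_{\mathfrak{p}}(x)$ is the exponent of $\mathfrak{p}$ in the factorisation of $(x)$. Set $V'_k=\{(m_1,m_2)\in\mathbb{Z}^2 : m_1+m_2\delta\text{ is }k\text{-free}\}$. Identifying subsets of $\mathbb{Z}^2$ with their characteristic functions in $\{0,1\}^{\mathbb{Z}^2}$ (product topology), the $k$-free shift induced by $K$ is the translation orbit closure $\overline{\{t+V'_k : t\in\mathbb{Z}^2\}}$ with the $\mathbb{Z}^2$-translation action. Two such shifts are topologically conjugate if there is a homeomorphism between them that intertwines the $\mathbb{Z}^2$-actions. *)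

(* Defs.v *)
From HB Require Import structures.
From mathcomp Require Import all_boot all_order all_algebra all_field.
From mathcomp Require Import ring_quotient.
From mathcomp Require Import ring.
From mathcomp Require Import all_classical topology.

Set Implicit Arguments.
Unset Strict Implicit.
Unset Printing Implicit Defensive.

Import Order.TTheory GRing.Theory Num.Theory.
Local Open Scope classical_set_scope.
Local Open Scope ring_scope.

Section IdealFactorisation.
Variable R : comNzRingType.
Implicit Types (P I J : set R) (x : R).

(* The library predicate [idealr_closed] includes properness (1 \notin P). *)
Definition prime_ideal P : Prop :=
  idealr_closed (mem P) /\ prime_idealr_closed (mem P).

Definition principal_ideal x : set R := [set a * x | a in [set: R]].

Definition mul_ideal I J : set R :=
  [set z | exists (n : nat) (a b : 'I_n -> R),
     (forall i, I (a i) /\ J (b i)) /\ z = \sum_(i < n) a i * b i].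

Definition prime_factorisation x (s : seq (set R)) : Prop :=
  (forall P, P \in s -> prime_ideal P) /\
  principal_ideal x = \big[mul_ideal/[set: R]]_(P <- s) P.

(* [get] returns a member of the given set of exponents, and 0 if that set is
   empty.  In a Dedekind domain, with x != 0, the set is a singleton. *)
Definition valuation P x : nat :=
  get [set n : nat | exists2 s, prime_factorisation x s & n = count_mem P s].

Definition kfree (k : nat) x : Prop :=
  x != 0 /\ forall P, prime_ideal P -> (valuation P x < k)%N.

End IdealFactorisation.

Definition squarefree (d : int) : Prop :=
  forall n : int, (n ^+ 2 %| d)%Z -> `|n|%N = 1%N.

Definition quadratic_radicand (d : int) : Prop :=
  [/\ squarefree d, d != 0 & d != 1].

Definition real_quadratic (d : int) : Prop := quadratic_radicand d /\ 0 < d.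
Definition imaginary_quadratic (d : int) : Prop := quadratic_radicand d /\ d < 0.

Definition quadratic_field (d : int) : set algC :=
  [set z | exists a b : rat, z = ratr a + ratr b * sqrtC d%:~R].

Definition ring_of_integers_pred (d : int) : {pred algC} :=
  fun z => (z \in Aint) && (z \in quadratic_field d).

Lemma ring_of_integers_subring (d : int) : subring_closed (ring_of_integers_pred d).
Proof.
have sq : sqrtC (d%:~R : algC) * sqrtC d%:~R = ratr d%:~R.
  by rewrite -expr2 sqrtCK ratr_int.
split.
- rewrite unfold_in Aint1; apply/mem_set; exists 1, 0.
  by rewrite rmorph1 rmorph0 mul0r addr0.
- move=> x y /andP[Ax /set_mem[a [b E]]] /andP[Ay /set_mem[a' [b' E']]].
  rewrite unfold_in (rpredB Ax Ay); apply/mem_set.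
  exists (a - a'), (b - b').
  rewrite E E' !rmorphB /=; ring.
- move=> x y /andP[Ax /set_mem[a [b E]]] /andP[Ay /set_mem[a' [b' E']]].
  rewrite unfold_in (rpredM Ax Ay); apply/mem_set.
  exists (a * a' + b * b' * d%:~R), (a * b' + b * a').
  rewrite E E' !rmorphD !rmorphM /= -sq; ring.
Qed.

HB.instance Definition _ (d : int) :=
  GRing.isSubringClosed.Build algC (ring_of_integers_pred d) (ring_of_integers_subring d).

Record ring_of_integers (d : int) : Type := RingOfIntegers {
  ring_of_integers_val :> algC;
  ring_of_integers_valP : ring_of_integers_val \in ring_of_integers_pred d }.

HB.instance Definition _ (d : int) := [isSub for @ring_of_integers_val d].
HB.instance Definition _ (d : int) := [Choice of ring_of_integers d by <:].
HB.instance Definition _ (d : int) :=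
  [SubChoice_isSubComNzRing of ring_of_integers d by <:].

(* [(d %% 4)%Z] is the non-negative remainder, also for negative d. *)
Definition delta_val (d : int) : algC :=
  if (d %% 4)%Z == 1 then (1 + sqrtC d%:~R) / 2 else sqrtC d%:~R.

Lemma delta_subproof (d : int) : delta_val d \in ring_of_integers_pred d.
Proof.
rewrite unfold_in /delta_val; set s := sqrtC _.
have sq : s ^+ 2 = d%:~R by rewrite sqrtCK.
case: eqP => [d1|_]; apply/andP; split.
- have ed : (d%:~R : algC) = (d %/ 4)%Z%:~R * 4 + 1.
    by rewrite {1}(divz_eq d 4) d1 rmorphD rmorphM.
  apply: (@root_monic_Aint ('X ^+ 2 - 'X - ((d %/ 4)%Z%:~R)%:P)).
  + rewrite rootE !hornerE; apply/eqP.
    have -> : ((1 + s) / 2) ^+ 2 - (1 + s) / 2 = (s ^+ 2 - 1) / 4 by field.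
    by rewrite sq ed; field.
  + rewrite monicE lead_coefE.
    have sz : size ('X^2 - 'X - ((d %/ 4)%Z%:~R)%:P : {poly algC}) = 3.
      rewrite -addrA -opprD size_polyDl ?size_polyXn // size_polyN.
      by rewrite size_XaddC.
    by rewrite sz /= !coefE subr0 subr0.
  + apply/polyOverP => i; rewrite !coefE.
    by rewrite !rpredB ?rpred_nat //; case: ifP; rewrite ?rpred_int ?rpred0.
- apply/mem_set; exists (1 / 2), (1 / 2).
  by rewrite fmorph_div rmorph1 rmorph_nat -/s; field.
- apply: (@root_monic_Aint ('X^2 - (d%:~R)%:P)).
  + by rewrite rootE !hornerE sq subrr.
  + exact: monicXnsubC.
  + by rewrite polyOverXnsubC intr_int.
- apply/mem_set; exists 0, 1.
  by rewrite rmorph0 rmorph1 add0r mul1r.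
Qed.

Definition delta (d : int) : ring_of_integers d := RingOfIntegers (delta_subproof d).

Definition kfree_points (d : int) (k : nat) : set (int * int) :=
  [set m | kfree k (m.1%:~R + m.2%:~R * delta d)].

Definition config : Type := {ptws (int * int) -> bool}.

HB.instance Definition _ := Topological.on config.

Definition indicator (V : set (int * int)) : config := fun m => m \in V.

(* [translate t (indicator V)] is the indicator of t + V. *)
Definition translate (t : int * int) (x : config) : config :=
  fun m => x (m - t).

Definition kfree_shift (d : int) (k : nat) : set config :=
  closure [set translate t (indicator (kfree_points d k)) | t in [set: int * int]].

(* The values of f outside X and of g outside Y are irrelevant. *)
Definition topologically_conjugate (X Y : set config) : Prop :=
  exists f g : config -> config,
    [/\ set_fun X Y f, set_fun Y X g, {in X, cancel f g} & {in Y, cancel g f}] /\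
    [/\ {within X, continuous f}, {within Y, continuous g} &
        forall t, {in X, forall x, f (translate t x) = translate t (f x)}].

(* Main.v *)
(* The lattices of prime powers are visible to the dynamics, and they determine
   the field.  Let f be a conjugacy from the shift of Q(sqrt d) to that of
   Q(sqrt e).  It fixes the empty configuration, the only constant one, so the
   image of a single point is nonempty; by continuity and equivariance there is a
   vector a with S + a contained in f(S) for every sufficiently sparse finite S in
   the first shift.

   Let p be a large prime that splits in Q(sqrt e), and let r be a root modulo p^l
   of the minimal polynomial of delta_e, so that m1 + m2 r = 0 (mod p^l) defines the
   l-th power of a prime ideal; every configuration of the second shift misses a
   coset of it on each finite window.  Take S = Q c, where c runs over the points of
   the box of side p^l whose norm in Q(sqrt d) is prime to p, and Q is divisible by
   the other small primes and large.  A sieve shows that S lies in the first shift.  Since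
   S + a misses a coset, the norm form of Q(sqrt d) is divisible by p along a whole
   line of direction (-r, 1), hence r is a root modulo p of the minimal polynomial of
   delta_d as well.  The same holds for the conjugate root, so the two minimal
   polynomials agree modulo p.  As p is large they are equal, contradicting the
   signs of the discriminants. *)
Require Import Defs.
From mathcomp Require Import all_boot all_order all_algebra all_field.
From mathcomp Require Import ring_quotient zify ring lra.
From mathcomp Require Import all_classical topology.

Set Implicit Arguments.
Unset Strict Implicit.
Unset Printing Implicit Defensive.

Import Order.TTheory GRing.Theory Num.Theory.
Local Open Scope classical_set_scope.
Local Open Scope ring_scope.

(** * Ideals of a quadratic order *)

(** The norm of [m.1 + m.2 * w] when [w] is a root of f(X) = X^2 - t X + n. *)
Definition norm_form (t n : int) (m : int * int) : int :=
  m.1 ^+ 2 + t * m.1 * m.2 + n * m.2 ^+ 2.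

Record quadratic_order (R : comNzRingType) (w : R) (t n : int) : Prop := {
  gen_sqr : w ^+ 2 = t%:~R * w - n%:~R;
  gen_span : forall x : R, exists m : int * int, x = m.1%:~R + m.2%:~R * w;
  gen_free : forall m : int * int, m.1%:~R + m.2%:~R * w = 0 -> m = 0;
  norm_form_eq0 : forall m, norm_form t n m = 0 -> m = 0;
  (* the order is maximal at the ramified primes *)
  ramified_maximal : forall (q : nat) (r : int), prime q ->
    (q%:Z %| 2 * r - t)%Z -> ~ (q%:Z ^+ 2 %| r ^+ 2 - t * r + n)%Z }.

Lemma prime_dvdzM (q : nat) (a b : int) : prime q ->
  (q%:Z %| a * b)%Z -> (q%:Z %| a)%Z \/ (q%:Z %| b)%Z.
Proof.
move=> pq; rewrite !dvdzE abszM Euclid_dvdM //= => /orP[]; by [left|right].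
Qed.

Lemma bezout_prime (q : nat) (a : int) : prime q -> ~ (q%:Z %| a)%Z ->
  exists u v : int, u * a + v * q%:Z = 1.
Proof.
move=> pq na; have [u [v e]] := Bezoutz a q%:Z.
exists u, v; rewrite e; congr Posz.
have: coprime q `|a| by rewrite prime_coprime //; apply/negP.
by rewrite coprime_sym => /eqP.
Qed.

(** * Ideals and their products in a commutative ring *)

Section Ideals.
Variable R : comNzRingType.
Implicit Types (I J P : set R) (x y a b : R).

(** The unit ideal qualifies, as it must: it is the empty product of prime ideals. *)
Definition ideal I := I 0 /\ forall a x y, I x -> I y -> I (a * x + y).

Lemma idealD I x y : ideal I -> I x -> I y -> I (x + y).
Proof. by move=> [_ h] hx hy; rewrite -[x]mul1r; apply: h. Qed.

Lemma idealM I a x : ideal I -> I x -> I (a * x).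
Proof. by move=> [h0 h] hx; rewrite -[_ * _]addr0; apply: h. Qed.

Lemma idealB I x y : ideal I -> I x -> I y -> I (x - y).
Proof. by move=> hI hx hy; apply: idealD => //; rewrite -mulN1r; apply: idealM. Qed.

Lemma prime_idealP P : prime_ideal P <->
  [/\ ideal P, ~ P 1 & forall x y, P (x * y) -> P x \/ P y].
Proof.
split=> [[[h0 h1 h] hp]|[[h0 h] h1 hp]].
  split; first split.
  - exact/set_mem.
  - by move=> a x y hx hy; apply/set_mem/h; apply/mem_set.
  - by move=> hP; move/negP: h1; apply; apply/mem_set.
  - move=> x y hxy; have /hp/orP[/set_mem|/set_mem] : x * y \in P by apply/mem_set.
      by left.
    by right.
split; first split.
- exact/mem_set.
- by apply/negP => /set_mem.
- by move=> a x y /set_mem hx /set_mem hy; apply/mem_set/h.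
- by move=> x y /set_mem/hp[] hh; apply/orP; [left|right]; apply/mem_set.
Qed.

Lemma mul_ideal_prod I J a b : I a -> J b -> mul_ideal I J (a * b).
Proof.
move=> ha hb; exists 1%N, (fun=> a), (fun=> b); split => //.
by rewrite big_ord1.
Qed.

(** The elimination rule for products. [K] can be any additive property, for instance divisibility
    by an integer, and is tested on generators. *)
Lemma mul_ideal_min I J (K : set R) : K 0 -> (forall x y, K x -> K y -> K (x + y)) ->
  (forall a b, I a -> J b -> K (a * b)) -> mul_ideal I J `<=` K.
Proof.
move=> K0 KD KM z [m [a [b [hab ->]]]].
by apply: big_ind => // i _; case: (hab i) => ha hb; apply: KM.
Qed.

Lemma mul_ideal0 I J : mul_ideal I J 0.
Proof.
exists 0%N, (fun=> 0), (fun=> 0); split; first by case.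
by rewrite big_ord0.
Qed.

Lemma mul_idealD I J x y : mul_ideal I J x -> mul_ideal I J y ->
  mul_ideal I J (x + y).
Proof.
move=> [m [a [b [hab ->]]]] [m' [a' [b' [hab' ->]]]].
pose c (f : 'I_m -> R) (g : 'I_m' -> R) (i : 'I_(m + m')) :=
  match fintype.split i with inl j => f j | inr j => g j end.
exists (m + m')%N, (c a a'), (c b b'); split.
  by move=> i; rewrite /c; case: (fintype.split i) => j.
rewrite big_split_ord /=; congr (_ + _); apply: eq_bigr => i _; rewrite /c.
  by rewrite (unsplitK (inl i)).
by rewrite (unsplitK (inr i)).
Qed.

Lemma mul_ideal_ideal I J : ideal I -> ideal (mul_ideal I J).
Proof.
move=> hI; split; first exact: mul_ideal0.
move=> a x y hx; apply: mul_idealD; move: x hx.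
apply: mul_ideal_min => [|x z|b c hb hc].
- by rewrite mulr0; apply: mul_ideal0.
- by rewrite mulrDr; apply: mul_idealD.
- by rewrite mulrA; apply: mul_ideal_prod => //; apply: idealM.
Qed.

Lemma mul_ideal_subr I J : ideal J -> mul_ideal I J `<=` J.
Proof.
move=> hJ; apply: mul_ideal_min => [|x y|a b _ hb]; [by case: hJ|exact: idealD|].
exact: idealM.
Qed.

Lemma idealT : ideal [set: R].
Proof. by []. Qed.

Lemma ideal_prod (s : seq (set R)) : (forall P, P \in s -> ideal P) ->
  ideal (\big[@mul_ideal R/[set: R]]_(P <- s) P).
Proof.
elim: s => [|P s IH] hs; first by rewrite big_nil; apply: idealT.
by rewrite big_cons; apply: mul_ideal_ideal; apply: hs; rewrite inE eqxx.
Qed.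

End Ideals.

(** * Conjugation, divisibility and the primes over a rational prime *)

Section QuadraticOrder.
Variables (R : comNzRingType) (w : R) (t n : int).
Hypothesis O : quadratic_order w t n.
Implicit Types (I J P : set R) (x y a b : R).

Definition el (m : int * int) : R := m.1%:~R + m.2%:~R * w.

Lemma el_inj : injective el.
Proof.
move=> m m' e; apply/eqP; rewrite -subr_eq0; apply/eqP/(gen_free O).
move: e; rewrite /el /= !rmorphB /= => e.
have -> : m.1%:~R - m'.1%:~R + (m.2%:~R - m'.2%:~R) * w =
  (m.1%:~R + m.2%:~R * w) - (m'.1%:~R + m'.2%:~R * w) by ring.
by rewrite e subrr.
Qed.

Lemma elD m m' : el (m + m') = el m + el m'.
Proof. by rewrite /el /= !rmorphD /=; ring. Qed.

Lemma elB m m' : el (m - m') = el m - el m'.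
Proof. by rewrite /el /= !rmorphB /=; ring. Qed.

Lemma elM m m' : el m * el m' =
  el (m.1 * m'.1 - n * m.2 * m'.2, m.1 * m'.2 + m.2 * m'.1 + t * m.2 * m'.2).
Proof.
rewrite /el /= !(rmorphB, rmorphD, rmorphM) /=.
have -> : (m.1%:~R + m.2%:~R * w) * (m'.1%:~R + m'.2%:~R * w) =
  m.1%:~R * m'.1%:~R + (m.1%:~R * m'.2%:~R + m.2%:~R * m'.1%:~R) * w
   + m.2%:~R * m'.2%:~R * w ^+ 2 by ring.
rewrite (gen_sqr O); ring.
Qed.

Lemma el_int (z : int) : z%:~R = el (z, 0).
Proof. by rewrite /el /= mul0r addr0. Qed.

Definition coord x : int * int := projT1 (cid (gen_span O x)).

Lemma coordK x : el (coord x) = x.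
Proof. by rewrite /coord /el; case: cid. Qed.

Lemma elK m : coord (el m) = m.
Proof. by apply: el_inj; rewrite coordK. Qed.

(** The automorphism sending [w] to [t - w]. *)
Definition conj x : R := el ((coord x).1 + t * (coord x).2, - (coord x).2).

Lemma conj_el m : conj (el m) = el (m.1 + t * m.2, - m.2).
Proof. by rewrite /conj elK. Qed.

Lemma conjK x : conj (conj x) = x.
Proof.
rewrite -[x]coordK !conj_el /=; congr (el _); case: (coord x) => a b /=.
congr (_, _); ring.
Qed.

Lemma conjD x y : conj (x + y) = conj x + conj y.
Proof.
rewrite -[x]coordK -[y]coordK -elD !conj_el -elD; congr (el _).
congr (_, _) => /=; ring.
Qed.

Lemma conjM x y : conj (x * y) = conj x * conj y.
Proof.
rewrite -[x]coordK -[y]coordK elM !conj_el elM; congr (el _).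
congr (_, _) => /=; ring.
Qed.

Lemma conj_int (z : int) : conj z%:~R = z%:~R.
Proof. by rewrite !el_int conj_el /= mulr0 addr0 oppr0. Qed.

Lemma conj0 : conj 0 = 0.
Proof. exact: (conj_int 0). Qed.

Lemma conj1 : conj 1 = 1.
Proof. exact: (conj_int 1). Qed.

Lemma mul_conj m : el m * conj (el m) = (norm_form t n m)%:~R.
Proof.
rewrite conj_el elM el_int; congr (el _); rewrite /norm_form.
congr (_, _) => /=; ring.
Qed.

Definition dvO (N : int) x := exists y, x = N%:~R * y.

Lemma dvO_el N m : dvO N (el m) <-> (N %| m.1)%Z /\ (N %| m.2)%Z.
Proof.
split=> [[y]|[/dvdzP[a ea] /dvdzP[b eb]]].
  rewrite -[y]coordK el_int elM => /el_inj -> /=.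
  rewrite !mulr0 !mul0r subr0 !addr0; split; exact: dvdz_mulr.
exists (el (a, b)); rewrite /el /= ea eb !rmorphM /=; ring.
Qed.

Lemma dvO_int N (z : int) : dvO N z%:~R -> (N %| z)%Z.
Proof. by rewrite el_int => /dvO_el[]. Qed.

Lemma dvOD N x y : dvO N x -> dvO N y -> dvO N (x + y).
Proof. by move=> [a ->] [b ->]; exists (a + b); rewrite mulrDr. Qed.

Lemma dvOMl N a x : dvO N x -> dvO N (a * x).
Proof. by move=> [b ->]; exists (a * b); ring. Qed.

Lemma dvO0 N : dvO N 0.
Proof. by exists 0; rewrite mulr0. Qed.

Lemma mulIz (N : int) x y : N != 0 -> N%:~R * x = N%:~R * y -> x = y.
Proof.
move=> N0; rewrite -[x]coordK -[y]coordK el_int !elM => /el_inj /=.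
rewrite !mulr0 !mul0r !subr0 => e.
have e1 : (coord x).1 = (coord y).1 := mulfI N0 (congr1 fst e).
have e2 : (coord x).2 = (coord y).2 := mulfI N0 (congr1 snd e).
by move: e1 e2; case: (coord x) (coord y) => [? ?] [? ?] /= -> ->.
Qed.

Lemma conj_ideal I : ideal I -> ideal (I \o conj).
Proof.
move=> [h0 h]; split; first by rewrite /= conj0.
by move=> a x y hx hy /=; rewrite conjD conjM; apply: h.
Qed.

Lemma conj_prime_ideal P : prime_ideal P -> prime_ideal (P \o conj).
Proof.
move=> /prime_idealP[hI h1 hp]; apply/prime_idealP; split.
- exact: conj_ideal.
- by rewrite /= conj1.
- by move=> x y /=; rewrite conjM; apply: hp.
Qed.

(* [P] is prime of norm [N] over [q]: [P * conj P = (N)], and [P] is maximal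
   among primes. *)
Definition prime_above (q : nat) (N : int) P :=
  [/\ prime_ideal P, P q%:R, (1 < N) /\ (q%:Z %| N)%Z,
      (forall x y, P x -> P y -> dvO N (x * conj y)) /\
      mul_ideal P (P \o conj) N%:~R
    & forall P', prime_ideal P' -> P `<=` P' -> P' `<=` P].

Lemma prime_above_conj q N P : prime_above q N P -> prime_above q N (P \o conj).
Proof.
move=> [pP qP hN [h1 h2] hm]; split => //.
- exact: conj_prime_ideal.
- by rewrite /= pmulrn conj_int -pmulrn.
- split.
    move=> x y hx hy; have [z e] := h1 _ _ hx hy.
    by exists (conj z); rewrite -[LHS]conjK conjM e conjM conj_int.
  suff h : mul_ideal P (P \o conj) `<=` mul_ideal (P \o conj) (P \o conj \o conj) \o conj.
    by have := h _ h2; rewrite /= conj_int.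
  apply: mul_ideal_min.
  - by rewrite /= conj0; apply: mul_ideal0.
  - by move=> x y /=; rewrite conjD; apply: mul_idealD.
  - move=> a b ha hb /=; rewrite conjM; apply: mul_ideal_prod => //=; by rewrite !conjK.
- move=> P' pP' sub x P'x /=.
  apply: (hm (P' \o conj)); first exact: conj_prime_ideal.
    by move=> y Py /=; apply: sub; rewrite /= conjK.
  by rewrite /= conjK.
Qed.

(** The kernel of the map to Z/q with [w] sent to [r], a ring homomorphism once [q] divides f(r).
    Here [q] may be a prime power: this gives the powers of a split prime. *)
Definition lin_ideal (q : int) (r : int) : set R :=
  [set x | (q %| (coord x).1 + (coord x).2 * r)%Z].

Lemma lin_ideal_el q r m : lin_ideal q r (el m) = (q %| m.1 + m.2 * r)%Z.
Proof. by rewrite /lin_ideal /= elK. Qed.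

Lemma lin_ideal_mul (q r : int) x y : (q %| r ^+ 2 - t * r + n)%Z ->
  (q %| (coord (x * y)).1 + (coord (x * y)).2 * r
     - ((coord x).1 + (coord x).2 * r) * ((coord y).1 + (coord y).2 * r))%Z.
Proof.
move=> qf; rewrite -{1 2}[x]coordK -{1 2}[y]coordK elM !elK /=.
move: (coord x) (coord y) => [a b] [c d] /=.
have -> : a * c - n * b * d + (a * d + b * c + t * b * d) * r -
  (a + b * r) * (c + d * r) = - (b * d) * (r ^+ 2 - t * r + n) by ring.
exact: dvdz_mull.
Qed.

Lemma lin_ideal_ideal q r : (q %| r ^+ 2 - t * r + n)%Z -> ideal (lin_ideal q r).
Proof.
move=> qf; split; first by rewrite -(mulr0z 1) el_int lin_ideal_el /= mul0r dvdz0.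
move=> a x y hx hy; rewrite /lin_ideal /=.
have e : coord (a * x + y) = coord (a * x) + coord y.
  by apply: el_inj; rewrite elD !coordK.
rewrite e /=.
have h := lin_ideal_mul a x qf.
have -> : (coord (a * x)).1 + (coord y).1 + ((coord (a * x)).2 + (coord y).2) * r =
 ((coord (a * x)).1 + (coord (a * x)).2 * r
     - ((coord a).1 + (coord a).2 * r) * ((coord x).1 + (coord x).2 * r)) +
 (((coord a).1 + (coord a).2 * r) * ((coord x).1 + (coord x).2 * r)) +
 ((coord y).1 + (coord y).2 * r) by ring.
by apply: rpredD => //; apply: rpredD => //; apply: dvdz_mull.
Qed.

Lemma lin_ideal_prime (q : nat) r : prime q -> (q%:Z %| r ^+ 2 - t * r + n)%Z ->
  prime_ideal (lin_ideal q r).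
Proof.
move=> pq qf; apply/prime_idealP; split; first exact: lin_ideal_ideal.
- rewrite -(mulr1z 1) el_int lin_ideal_el /= mul0r addr0 dvdz1 absz_nat.
  by move=> /eqP q1; rewrite q1 in pq.
- move=> x y h; apply: (prime_dvdzM pq).
  have := rpredB (h : (q%:Z %| _)%Z) (lin_ideal_mul x y qf).
  by rewrite opprB addrCA subrr addr0.
Qed.

Lemma lin_ideal_int (q r z : int) : lin_ideal q r z%:~R = (q %| z)%Z.
Proof. by rewrite el_int lin_ideal_el /= mul0r addr0. Qed.

Lemma prime_ideal_int P (q : nat) (z : int) : prime q -> prime_ideal P ->
  P q%:R -> P z%:~R -> (q%:Z %| z)%Z.
Proof.
move=> pq /prime_idealP[hI h1 _] hq hz; case: (boolP (q%:Z %| z)%Z) => // /negP nz.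
case: h1; have [u [v e]] := bezout_prime pq nz.
have -> : 1 = u%:~R * z%:~R + v%:~R * q%:R :> R.
  by rewrite [q%:R]pmulrn -!intrM -intrD e.
by apply: idealD => //; apply: idealM.
Qed.

Lemma el_mul_conj m m' : el m * conj (el m') =
  el (m.1 * m'.1 + t * m.1 * m'.2 + n * m.2 * m'.2, m.2 * m'.1 - m.1 * m'.2).
Proof. rewrite conj_el elM; congr el; congr (_, _) => /=; ring. Qed.

(** The product of [P] and its conjugate contains q^2, f(r) and q (t - 2r). If [r] is a simple root
    modulo [q], the first and the last have gcd [q]; if it is a double root, [ramified_maximal]
    makes q^2 and f(r) have gcd [q]. The ideal is maximal among primes because every element is an
    integer modulo [w - r]. *)
Lemma lin_ideal_above (q : nat) r : prime q -> (q%:Z %| r ^+ 2 - t * r + n)%Z ->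
  prime_above q q (lin_ideal q r).
Proof.
move=> pq qf.
have Pq : lin_ideal q r q%:R by rewrite pmulrn lin_ideal_int dvdzz.
have hP := lin_ideal_prime pq qf.
have [hI h1 _] := (prime_idealP _).1 hP.
have q0 : q%:Z != 0 by case: q pq {qf Pq hP hI h1}.
split => //.
- by split; [case: q pq {qf Pq hP hI h1 q0} => [|[]]|rewrite dvdzz].
- split.
    move=> x y; rewrite -[x]coordK -[y]coordK !lin_ideal_el.
    move: (coord x) (coord y) => [a b] [c d] /= h h'.
    rewrite el_mul_conj; apply/dvO_el => /=; split.
      have -> : a * c + t * a * d + n * b * d =
        (a + b * r) * (c + t * d) - (c + d * r) * (b * r) - t * b * r * d + t * b * r * d
        + (b * d) * (r ^+ 2 - t * r + n) by ring.
      rewrite subrK; apply: rpredD; last exact: dvdz_mull.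
      by apply: rpredB; apply: dvdz_mulr.
    have -> : b * c - a * d = b * (c + d * r) - d * (a + b * r) by ring.
    by apply: rpredB; apply: dvdz_mull.
  set PP := mul_ideal _ _.
  have hPP : ideal PP by apply: mul_ideal_ideal.
  have PPq : PP (q%:R * q%:R).
    by apply: mul_ideal_prod => //=; rewrite pmulrn conj_int -pmulrn.
  have Pwr : lin_ideal q r (el (- r, 1)) by rewrite lin_ideal_el /= mul1r addNr dvdz0.
  have PPf : PP (r ^+ 2 - t * r + n)%:~R.
    suff -> : (r ^+ 2 - t * r + n)%:~R = el (- r, 1) * conj (el (- r, 1)).
      by apply: mul_ideal_prod => //=; rewrite conjK.
    rewrite mul_conj /norm_form /=; congr (_%:~R); ring.
  have PPt : PP (q%:~R * (t - 2 * r)%:~R).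
    have -> : q%:~R * (t - 2 * r)%:~R = q%:R * conj (el (- r, 1)) + el (- r, 1) * q%:R :> R.
      rewrite [q%:R]pmulrn conj_el el_int !elM -elD el_int elM; congr el.
      congr (_, _) => /=; ring.
    apply: idealD => //; apply: mul_ideal_prod => //=; rewrite ?conjK //.
    by rewrite pmulrn conj_int -pmulrn.
  case: (boolP (q%:Z %| t - 2 * r)%Z) => [qt|/negP nqt].
    have nq2 : ~ (q%:Z ^+ 2 %| r ^+ 2 - t * r + n)%Z.
      by apply: (ramified_maximal O pq); rewrite -opprB rpredN.
    have /dvdzP[g eg] := qf.
    have ng : ~ (q%:Z %| g)%Z.
      by move=> /dvdzP[g' eg']; apply: nq2; rewrite eg eg' -mulrA -expr2 dvdz_mull.
    have [u [v e]] := bezout_prime pq ng.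
    have -> : (q%:Z)%:~R = u%:~R * (r ^+ 2 - t * r + n)%:~R + v%:~R * (q%:R * q%:R) :> R.
      rewrite [q%:R]pmulrn -!intrM -intrD eg; congr (_%:~R).
      by rewrite -[LHS]mul1r -[X in X * _]e; ring.
    by apply: idealD => //; apply: idealM.
  have [u [v e]] := bezout_prime pq nqt.
  have -> : (q%:Z)%:~R = u%:~R * (q%:~R * (t - 2 * r)%:~R) + v%:~R * (q%:R * q%:R) :> R.
    rewrite [q%:R]pmulrn -!intrM -intrD; congr (_%:~R).
    by rewrite -[LHS]mul1r -[X in X * _]e; ring.
  by apply: idealD => //; apply: idealM.
- move=> P' pP' sub x P'x.
  have [hI' _ _] := (prime_idealP _).1 pP'.
  have Pwr : lin_ideal q r (el (- r, 1)) by rewrite lin_ideal_el /= mul1r addNr dvdz0.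
  apply: (prime_ideal_int pq pP'); first exact: sub.
  have -> : ((coord x).1 + (coord x).2 * r)%:~R = x - (coord x).2%:~R * el (- r, 1).
    rewrite -[X in X - _]coordK !el_int elM -elB; congr el; congr (_, _) => /=; ring.
  apply: idealB => //; apply: idealM => //; exact: sub.
Qed.

(** When f has no root modulo [q], the norm form is anisotropic there, so an element whose norm is
    divisible by [q] is itself a multiple of [q]. Primality and maximality both follow. *)
Lemma inert_above (q : nat) : prime q ->
  (forall r, ~ (q%:Z %| r ^+ 2 - t * r + n)%Z) ->
  prime_above q (q%:Z ^+ 2) (dvO q).
Proof.
move=> pq nf.
have hI : ideal (dvO q).
  split; first exact: dvO0.
  by move=> a x y hx hy; apply: dvOD => //; apply: dvOMl.
have hN m : (q%:Z %| norm_form t n m)%Z -> dvO q (el m).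
  move=> hm; apply/dvO_el.
  suff h2 : (q%:Z %| m.2)%Z.
    split => //; have : (q%:Z %| m.1 * m.1)%Z.
      have -> : m.1 * m.1 = norm_form t n m - m.2 * (t * m.1 + n * m.2).
        by rewrite /norm_form; ring.
      by apply: rpredB => //; apply: dvdz_mulr.
    by move=> /(prime_dvdzM pq)[].
  case: (boolP (q%:Z %| m.2)%Z) => // /negP n2.
  have [u [v e]] := bezout_prime pq n2.
  (* [u] inverts [m.2] modulo [q], so this is the root [- m.1 / m.2]. *)
  case: (nf (- (u * m.1))).
  have -> : (- (u * m.1)) ^+ 2 - t * (- (u * m.1)) + n = u ^+ 2 * norm_form t n m
     + q%:Z * (v * ((u * m.2 + 1) * n + t * u * m.1)).
    rewrite /norm_form.
    have -> : q%:Z * (v * ((u * m.2 + 1) * n + t * u * m.1)) =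
      (v * q%:Z) * ((u * m.2 + 1) * n + t * u * m.1) by ring.
    have -> : v * q%:Z = 1 - u * m.2 by rewrite -e; ring.
    ring.
  by apply: rpredD; [apply: dvdz_mull|apply: dvdz_mulr].
have q0 : q%:Z != 0 by case: q pq {nf hN hI}.
have hcq : dvO q (conj q%:R) by rewrite pmulrn conj_int; exists 1; rewrite mulr1.
have hqq : dvO q q%:R by exists 1; rewrite mulr1 pmulrn.
have pP : prime_ideal (dvO q).
  apply/prime_idealP; split => //.
    rewrite -(mulr1z 1) => /dvO_int; rewrite dvdz1 absz_nat => /eqP q1.
    by rewrite q1 in pq.
  move=> x y; rewrite -[x]coordK -[y]coordK; move: (coord x) (coord y) => m m' [z e].
  have : (q%:Z %| norm_form t n m * norm_form t n m')%Z.
    apply: dvO_int; rewrite intrM -!mul_conj.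
    exists (z * (conj (el m) * conj (el m'))).
    by rewrite mulrACA e -mulrA.
  by move=> /(prime_dvdzM pq)[/hN|/hN]; [left|right].
split => //.
- split; last by rewrite expr2 dvdz_mulr.
  by case: q pq {nf hI hN q0 hcq hqq pP} => [|[]].
- split.
    move=> x y [z ->] [z' ->]; exists (z * conj z').
    by rewrite conjM conj_int rmorphXn /=; ring.
  have -> : (q%:Z ^+ 2)%:~R = q%:R * q%:R :> R by rewrite rmorphXn /= -pmulrn expr2.
  exact: mul_ideal_prod.
- move=> P' pP' sub x P'x; have [hI' _ _] := (prime_idealP _).1 pP'.
  rewrite -[x]coordK; apply: hN; apply: (prime_ideal_int pq pP'); first exact: sub.
  by rewrite -mul_conj coordK mulrC; apply: idealM.
Qed.

Lemma prime_above_ex (q : nat) : prime q -> exists N P, prime_above q N P.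
Proof.
move=> pq; case: (pselect (exists r, (q%:Z %| r ^+ 2 - t * r + n)%Z)).
  by move=> [r hr]; exists q, (lin_ideal q r); apply: lin_ideal_above.
move=> h; exists (q%:Z ^+ 2), (dvO q); apply: inert_above => // r hr.
by apply: h; exists r.
Qed.

(** If some [x] in [I] lies outside [P], then for [y] in [I] the product [x * conj y] is a multiple
    of [q], hence in [P], and primality leaves only [conj y]. *)
Lemma ideal_sub_prime_above q N P I : prime_above q N P -> ideal I ->
  (forall x y, I x -> I y -> dvO q (x * conj y)) -> I `<=` P \/ I `<=` P \o conj.
Proof.
move=> [/prime_idealP[hP _ pP] qP _ _ _] hI h.
case: (pselect (I `<=` P)) => [|nIP]; first by left.
right; have /existsNP[x /not_implyP[Ix nPx]] := nIP.
move=> y Iy /=; have [z e] := h _ _ Ix Iy.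
have : P (x * conj y) by rewrite e -pmulrn mulrC; apply: idealM.
by case/pP.
Qed.

(** The product of [P] and its conjugate consists of multiples of [q], so it lies in [P']. Hence
    [P'] contains one of the two, and the maximality of that one reverses the inclusion. *)
Lemma prime_above_unique q N P P' : prime_above q N P -> prime_ideal P' -> P' q%:R ->
  P' `<=` P \/ P' `<=` P \o conj.
Proof.
move=> hP pP' qP'; have hPc := prime_above_conj hP.
have [/prime_idealP[iP _ _] _ [_ /dvdzP[c eN]] [h _] hm] := hP.
have [_ _ _ _ hmc] := hPc.
have [iP' _ prP'] := (prime_idealP _).1 pP'.
have hq x y : P x -> P y -> P' x \/ P' (conj y).
  move=> Px Py; have [z e] := h _ _ Px Py; apply: prP'.
  have -> : x * conj y = (c%:~R * z) * q%:R by rewrite e eN intrM -pmulrn; ring.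
  exact: idealM.
case: (pselect (P `<=` P')) => [/(hm _ pP')|nPP]; first by left.
right; apply: hmc => // y /= Py; have /existsNP[x /not_implyP[Px nP'x]] := nPP.
by case: (hq _ _ Px Py) => //; rewrite conjK.
Qed.

End QuadraticOrder.

(** * Factorisation of principal ideals *)

Section PowIdeal.
Variable R : comNzRingType.
Implicit Types (I J P : set R) (s : seq (set R)).

Lemma mul_ideal_subl I J : ideal I -> mul_ideal I J `<=` I.
Proof.
move=> hI; apply: mul_ideal_min => [|x y|a b ha _]; [by case: hI|exact: idealD|].
by rewrite mulrC; apply: idealM.
Qed.

Lemma mul_ideal_mono I I' J J' : I `<=` I' -> J `<=` J' ->
  mul_ideal I J `<=` mul_ideal I' J'.
Proof.
move=> hI hJ; apply: mul_ideal_min => [|x y|a b ha hb]; first exact: mul_ideal0.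
  exact: mul_idealD.
by apply: mul_ideal_prod; [apply: hI|apply: hJ].
Qed.

Definition pow_ideal P k : set R := iter k (@mul_ideal R P) [set: R].

Lemma pow_ideal_ideal P k : ideal P -> ideal (pow_ideal P k).
Proof. by move=> hP; elim: k => [|k IH] /=; [exact: idealT|exact: mul_ideal_ideal]. Qed.

Lemma pow_ideal_mono P P' k : P `<=` P' -> pow_ideal P k `<=` pow_ideal P' k.
Proof. by move=> h; elim: k => [|k IH] //=; apply: mul_ideal_mono. Qed.

(** Each occurrence of [P] contributes one power; the other factors are absorbed. *)
Lemma prod_sub_pow_ideal P s k : (forall Q, Q \in s -> ideal Q) ->
  (k <= count_mem P s)%N ->
  \big[@mul_ideal R/[set: R]]_(Q <- s) Q `<=` pow_ideal P k.
Proof.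
elim: s k => [|Q s IH] k hs /=; first by rewrite leqn0 => /eqP ->.
have hs' Q' : Q' \in s -> ideal Q' by move=> h; apply: hs; rewrite inE h orbT.
have hQ : ideal Q by apply: hs; rewrite inE eqxx.
rewrite big_cons; case: eqP => [->|_]; last first.
  rewrite add0n => hk; apply: (subset_trans (mul_ideal_subr _)); last exact: IH.
  exact: ideal_prod.
case: k => [|k] hk //=; apply: mul_ideal_mono => //; exact: IH.
Qed.

Lemma prime_ideal_has_prime P (z : int) : prime_ideal P -> P z%:~R -> z != 0 ->
  exists2 q : nat, prime q & P q%:R.
Proof.
move=> /prime_idealP[hI h1 hp].
suff h m : P m.+1%:R -> exists2 q : nat, prime q & P q%:R.
  move=> hz z0; have : P `|z|%N%:R.
    rewrite pmulrn abszEsign intrM; exact: idealM.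
  move: z0; rewrite -absz_eq0; case: `|z|%N => // m _; exact: h.
have [k] := ubnP m; elim: k m => // k IH m mk hm.
have [m1|m1] := leqP m 0%N.
  by move: m1 hm; rewrite leqn0 => /eqP -> /h1.
have pq : prime (pdiv m.+1) by apply: pdiv_prime.
have /dvdnP[c ec] := pdiv_dvd m.+1.
move: hm; rewrite {1}ec natrM => /hp[]; last by exists (pdiv m.+1).
case: c ec => [|c] // ec; apply: IH.
have := prime_gt1 pq; nia.
Qed.

End PowIdeal.

(** * Existence of prime factorisations *)

Section Factorisation.
Variables (R : comNzRingType) (w : R) (t n : int).
Hypothesis O : quadratic_order w t n.
Implicit Types (I J P : set R) (x y a b : R).
Local Notation conj := (conj O).

(* Here [I * conj I = (N)].  For a prime [P] of norm [M] containing [I], the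
   colon ideal [J = (I : P)] satisfies [I = P * J] and [J * conj J = (N / M)]. *)
Lemma prime_factorisation_of_norm (N : nat) I : (0 < N)%N -> ideal I ->
  (forall x y, I x -> I y -> dvO N (x * conj y)) ->
  mul_ideal I (I \o conj) N%:R ->
  exists s, (forall P, P \in s -> prime_ideal P) /\
    I = \big[@mul_ideal R/[set: R]]_(P <- s) P.
Proof.
have [k] := ubnP N; elim: k N I => // k IH N I Nk N0 hI hdv hmul.
have [N1|N1] := leqP N 1%N.
  exists [::]; split => //; rewrite big_nil; apply/seteqP; split => // x _.
  have N1' : N = 1%N by lia.
  rewrite -[x]mulr1; apply: idealM => //.
  by apply: (mul_ideal_subl hI (J := I \o conj)); rewrite N1' in hmul.
have pq := pdiv_prime N1; set q := pdiv N in pq.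
have /dvdnP[c ec] : (q %| N)%N := pdiv_dvd N.
have hq x y : I x -> I y -> dvO q (x * conj y).
  move=> hx hy; have [z ->] := hdv _ _ hx hy; exists (c%:R * z).
  by rewrite ec -!pmulrn natrM; ring.
have [M [P [hP IP]]] : exists M P, prime_above O q M P /\ I `<=` P.
  have [M [P hP]] := prime_above_ex O pq.
  case: (ideal_sub_prime_above hP hI hq) => h; first by exists M, P.
  by exists M, (P \o conj); split => //; apply: prime_above_conj.
have [pP qP [M1 _] [hM hPP] _] := hP.
have [iP _ _] := (prime_idealP _).1 pP.
(* [N] lies in [I * conj I], hence in [P * conj P], whose elements are multiples of [M]. *)
have [N2 eN] : exists N2 : nat, N%:Z = M * N2.
  suff /dvdzP[N2 eN] : (M %| N%:Z)%Z.
    exists `|N2|%N; rewrite eN mulrC; congr (_ * _).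
    have : 0 <= N2 * M by rewrite -eN.
    by rewrite pmulr_lge0 ?(lt_trans _ M1) // => /gez0_abs.
  apply: (dvO_int O); move: hmul; rewrite pmulrn.
  apply: mul_ideal_min => [|x y|a b ha hb]; [exact: dvO0|exact: dvOD|].
  rewrite -[b](conjK O); apply: hM; exact: IP.
pose J : set R := [set z | forall a, P a -> I (a * z)].
have hJ : ideal J.
  split => [a _|a x y hx hy b hb]; first by rewrite mulr0; case: hI.
  have -> : b * (a * x + y) = a * (b * x) + b * y by ring.
  by apply: idealD => //; [apply: idealM => //; apply: hx|apply: hy].
have M0 : M != 0 by rewrite gt_eqF // (lt_trans _ M1).
have eI : I = mul_ideal P J.
  apply/seteqP; split => [x Ix|]; last first.
    by apply: mul_ideal_min => [|x y|a b ha]; [case: hI|exact: idealD|apply].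
  (* For [a] in [P] and [b] in [conj P], [b * x] is [M] times an element of [J], so [a * b * x] is
     [M] times an element of [P * J]. As [M] itself lies in [P * conj P], it can be cancelled. *)
  suff h : mul_ideal P (P \o conj) `<=`
      [set u | exists2 y, mul_ideal P J y & u * x = M%:~R * y].
    by have [y hy /(mulIz O M0) ->] := h _ hPP.
  apply: mul_ideal_min.
  - by exists 0; [exact: mul_ideal0|rewrite mul0r mulr0].
  - move=> u v [y hy e] [z hz e']; exists (y + z); first exact: mul_idealD.
    by rewrite mulrDl e e' mulrDr.
  - move=> a b ha hb.
    have [z ez] := hM _ _ (IP _ Ix) hb; rewrite (conjK O) in ez.
    exists (a * z); last by rewrite mulrCA -ez; ring.
    apply: mul_ideal_prod => // a' ha'.
    have [z' ez'] := hM _ _ ha' hb; rewrite (conjK O) in ez'.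
    have -> : a' * z = z' * x.
      apply: (mulIz O M0); rewrite mulrCA -ez [RHS]mulrA -ez'; ring.
    exact: idealM.
have [||||s [hs eJ]] := IH N2 J _ _ hJ.
- have : N%:Z = M * N2 := eN; nia.
- case: N2 eN => // eN; lia.
- move=> z v hz hv.
  have h : mul_ideal P (P \o conj) `<=` [set u | dvO N (u * (z * conj v))].
    apply: mul_ideal_min => [|x y|a b ha hb] /=.
    - by rewrite mul0r; exact: dvO0.
    - by rewrite mulrDl; apply: dvOD.
    - have -> : a * b * (z * conj v) = (a * z) * conj (conj b * v).
        by rewrite (conjM O) (conjK O); ring.
      by apply: hdv; [apply: hz|apply: hv].
  have [y e] := h _ hPP; exists y; apply: (mulIz O M0).
  by rewrite e eN intrM mulrA.
- have h : mul_ideal I (I \o conj) `<=`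
      [set u | exists2 y, mul_ideal J (J \o conj) y & u = M%:~R * y].
    have K0 : exists2 y, mul_ideal J (J \o conj) y & 0 = M%:~R * y.
      by exists 0; [exact: mul_ideal0|rewrite mulr0].
    have KD u v : (exists2 y, mul_ideal J (J \o conj) y & u = M%:~R * y) ->
        (exists2 y, mul_ideal J (J \o conj) y & v = M%:~R * y) ->
        exists2 y, mul_ideal J (J \o conj) y & u + v = M%:~R * y.
      by move=> [y hy ->] [z hz ->]; exists (y + z); [exact: mul_idealD|rewrite mulrDr].
    apply: mul_ideal_min => // i j hi /= hj.
    rewrite -[j](conjK O); move: (conj j) hj => {}j hj.
    rewrite eI in hi hj; move: i hi.
    apply: mul_ideal_min => [|x y|a z ha hz] /=.
    - by rewrite mul0r.
    - by rewrite mulrDl; apply: KD.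
    - move: j hj.
      apply: mul_ideal_min => [|x y|b v hb hv].
      + by rewrite (conj0 O) mulr0.
      + have -> : a * z * conj (x + y) = a * z * conj x + a * z * conj y.
          by rewrite (conjD O); ring.
        exact: KD.
      + have [y e] := hM _ _ ha hb.
        exists ((y * z) * conj v).
          by apply: mul_ideal_prod; [exact: (idealM y hJ hz)|rewrite /= (conjK O)].
        rewrite (conjM O).
        have -> : a * z * (conj b * conj v) = (a * conj b) * (z * conj v) by ring.
        by rewrite e; ring.
  have [y hy e] := h _ hmul.
  suff -> : N2%:R = y by [].
  by apply: (mulIz O M0); rewrite -e pmulrn -intrM -eN -pmulrn.
exists (P :: s); split; last by rewrite big_cons -eJ.
by move=> Q; rewrite inE => /orP[/eqP ->|/hs].
Qed.

Lemma principal_ideal_ideal x : ideal (principal_ideal x).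
Proof.
split; first by exists 0; rewrite ?mul0r.
move=> a _ _ [b _ <-] [c _ <-]; exists (a * b + c) => //; ring.
Qed.

(** A principal ideal times its conjugate is generated by the norm; the factor [sgz N] passes to the
    positive generator. *)
Lemma prime_factorisation_ex m : m != 0 -> exists s, prime_factorisation (el w m) s.
Proof.
move=> m0; set N := norm_form t n m.
have N0 : N != 0 by apply: contra_neq m0; apply: (norm_form_eq0 O).
have [s hs] : exists s, (forall P, P \in s -> prime_ideal P) /\
    principal_ideal (el w m) = \big[@mul_ideal R/[set: R]]_(P <- s) P.
  apply: (@prime_factorisation_of_norm `|N|%N).
  - by rewrite absz_gt0.
  - exact: principal_ideal_ideal.
  - move=> _ _ [a _ <-] [b _ <-]; exists ((sgz N)%:~R * (a * conj b)).
    rewrite (conjM O) mulrACA (mul_conj O) -/N mulrCA mulrA.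
    by rewrite [in LHS](intEsg N) intrM; ring.
  - rewrite pmulrn abszEsg intrM /N -(mul_conj O) mulrA; apply: mul_ideal_prod.
      by exists (sgz N)%:~R.
    by exists 1; rewrite ?mul1r //= conjK.
by exists s.
Qed.

End Factorisation.

(** * Elements that are not k-free *)

Section KFree.
Variables (R : comNzRingType) (w : R) (t n : int).
Hypothesis O : quadratic_order w t n.
Implicit Types (I J P : set R) (x y a b : R) (s : seq (set R)).
Local Notation conj := (conj O).
Local Notation lin_ideal := (lin_ideal O).

(** A nonzero prime contains a rational prime, here necessarily [q]. It also contains f(r), the norm
    of [w - r], hence [w - r] or its conjugate; the conjugate maps to [t - 2 * r], nonzero modulo
    [q]. Finally [q] and [w - r] generate [lin_ideal q r]. *)
Lemma lin_ideal_maximal (q : nat) r P x : prime q ->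
  (q%:Z %| r ^+ 2 - t * r + n)%Z -> ~ (q%:Z %| 2 * r - t)%Z ->
  prime_ideal P -> P x -> x != 0 -> P `<=` lin_ideal q r -> P = lin_ideal q r.
Proof.
move=> pq qf nqr pP Px x0 sub; apply/seteqP; split => // y hy.
have [iP _ prP] := (prime_idealP _).1 pP.
have [z z0 Pz] : exists2 z : int, z != 0 & P z%:~R.
  exists (norm_form t n (coord O x)).
    apply: contra_neq x0 => /(norm_form_eq0 O) e.
    by rewrite -[x](coordK O) e /el /= mul0r addr0.
  by rewrite -(mul_conj O) (coordK O) mulrC; apply: idealM.
have [q' pq' Pq'] := prime_ideal_has_prime pP Pz z0.
have eq' : q' = q.
  have := sub _ Pq'; rewrite pmulrn lin_ideal_int dvdzE /= dvdn_prime2 //.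
  by move=> /eqP.
rewrite eq' in Pq'.
have Pwr : P (el w (- r, 1)).
  have : P (el w (- r, 1) * conj (el w (- r, 1))).
    rewrite (mul_conj O) /norm_form /=; move/dvdzP: qf => [c ec].
    have -> : (- r) ^+ 2 + t * (- r) * 1 + n * 1 ^+ 2 = c * q%:Z by rewrite -ec; ring.
    by rewrite intrM -pmulrn; apply: idealM.
  case/prP => // /sub; rewrite (conj_el O) lin_ideal_el /= => h; case: nqr.
  rewrite -rpredN; suff <- : - r + t * 1 + - 1 * r = - (2 * r - t) by [].
  ring.
move: hy; rewrite -[y](coordK O) lin_ideal_el; case: (coord O y) => y1 y2 /dvdzP[c /= ec].
have -> : el w (y1, y2) = c%:~R * q%:R + y2%:~R * el w (- r, 1).
  rewrite [q%:R]pmulrn -intrM -ec !(el_int w) !(elM O) -elD; congr el.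
  congr (_, _) => /=; ring.
by apply: idealD => //; apply: idealM.
Qed.

Lemma prod_ideal_neq0 (s : seq (set R)) Q x : (forall P, P \in s -> ideal P) ->
  (\big[@mul_ideal R/[set: R]]_(P <- s) P) x -> x != 0 -> Q \in s ->
  exists2 y, Q y & y != 0.
Proof.
elim: s => // P s IH hs; rewrite big_cons => hx x0.
have hs' Q' : Q' \in s -> ideal Q' by move=> h; apply: hs; rewrite inE h orbT.
have hP : ideal P by apply: hs; rewrite inE eqxx.
rewrite inE => /orP[/eqP ->|].
  by exists x => //; apply: (mul_ideal_subl hP) hx.
apply: IH => //; apply: mul_ideal_subr hx; exact: ideal_prod.
Qed.

(** Induction along the product. A factor equal to [lin_ideal q r] contains [q], and dividing by [q]
    lowers [j] by one. Any other factor has an element that maps to a unit modulo powers of [q],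
    which can be cancelled without changing [j]. *)
Lemma count_lin_ideal (q : nat) r k j s x : prime q ->
  (q%:Z ^+ k %| r ^+ 2 - t * r + n)%Z -> ~ (q%:Z %| 2 * r - t)%Z -> (j <= k)%N ->
  (forall P, P \in s -> prime_ideal P) ->
  (\big[@mul_ideal R/[set: R]]_(P <- s) P) x -> x != 0 ->
  \big[@mul_ideal R/[set: R]]_(P <- s) P `<=` lin_ideal (q%:Z ^+ j) r ->
  (j <= count_mem (lin_ideal q r) s)%N.
Proof.
move=> pq qf nqr jk hs hx x0.
have ids P : P \in s -> ideal P by move=> /hs/prime_idealP[].
have hn Q : Q \in s -> exists2 y, Q y & y != 0.
  by move=> hQ; apply: (prod_ideal_neq0 ids hx).
move: jk hs ids hn {x hx x0}; elim: s j => [|Q s IH] j jk hs ids hn.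
  rewrite big_nil => sub; rewrite leqNgt; apply/negP => j0.
  have := sub 1 I; rewrite -(mulr1z 1) lin_ideal_int dvdz1 abszX absz_nat.
  by move=> /eqP; have := ltn_expl j (prime_gt1 pq); lia.
have hs' P : P \in s -> prime_ideal P by move=> h; apply: hs; rewrite inE h orbT.
have ids' P : P \in s -> ideal P by move=> h; apply: ids; rewrite inE h orbT.
have hn' P : P \in s -> exists2 y, P y & y != 0.
  by move=> h; apply: hn; rewrite inE h orbT.
rewrite big_cons /= => sub.
case: j jk sub => // j jk sub.
have qfj i : (i <= j.+1)%N -> (q%:Z ^+ i %| r ^+ 2 - t * r + n)%Z.
  by move=> ij; apply: dvdz_trans qf; apply: dvdz_exp2l; lia.
have qf1 : (q%:Z %| r ^+ 2 - t * r + n)%Z by apply: (qfj 1%N).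
have q0 : q%:Z != 0 by case: (q) pq.
case: eqP => [eQ|nQ] /=.
  rewrite add1n ltnS; apply: IH => //; first by lia.
  move=> y hy; have Qq : Q q%:~R by rewrite eQ lin_ideal_int dvdzz.
  have := sub _ (mul_ideal_prod Qq hy).
  rewrite -[y](coordK O) (el_int w) (elM O) !lin_ideal_el /=.
  rewrite !mul0r !mulr0 subr0 !mul0r !addr0.
  by rewrite -mulrA -mulrDr exprS dvdz_mul2l.
rewrite add0n; apply: IH => // y hy.
have [z Qz nz] : exists2 z, Q z & ~ lin_ideal q r z.
  have [u Qu u0] := hn Q (mem_head _ _).
  have pQ := hs Q (mem_head _ _).
  have : ~ (Q `<=` lin_ideal q r).
    by move=> h; apply: nQ; apply: (lin_ideal_maximal pq qf1 nqr pQ Qu u0 h).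
  by move=> /existsNP[z /not_implyP[]]; exists z.
have := sub _ (mul_ideal_prod Qz hy).
have := lin_ideal_mul O z y (qfj j.+1 (leqnn _)).
rewrite /lin_ideal /= => h1 h2.
have := rpredB h2 h1; rewrite opprB addrCA subrr addr0 Gauss_dvdzr //.
rewrite coprimezE; move: nz; rewrite /lin_ideal /=; move: (_ + _) => c nc.
rewrite abszX absz_nat coprimeXl // prime_coprime //.
exact/negP.
Qed.

Lemma lin_ideal_not_kfree (q : nat) r k m : prime q ->
  (q%:Z ^+ k %| r ^+ 2 - t * r + n)%Z -> ~ (q%:Z %| 2 * r - t)%Z -> (0 < k)%N ->
  (q%:Z ^+ k %| m.1 + m.2 * r)%Z -> ~ kfree k (el w m).
Proof.
move=> pq qf nqr k0 hm [x0 hv].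
have qf1 : (q%:Z %| r ^+ 2 - t * r + n)%Z.
  by apply: dvdz_trans qf; case: (k) k0 => // k' _; rewrite exprS dvdz_mulr.
have := hv _ (lin_ideal_prime O pq qf1).
rewrite ltnNge => /negP; apply; rewrite /valuation.
have m0 : m != 0 by apply: contra_neq x0 => ->; rewrite /el /= mul0r addr0.
have [s0 hs0] := prime_factorisation_ex O m0.
(* [get] returns the count in some factorisation; the bound below applies to whichever one it is. *)
have := @getPex _ [set i : nat | exists2 s, prime_factorisation (el w m) s &
  i = count_mem (lin_ideal q r) s] (ex_intro _ _ (ex_intro2 _ _ s0 hs0 erefl)).
move=> [s [hs e] ->].
apply: (@count_lin_ideal q r k k s (el w m)) => //.
  by rewrite -e; exists 1; rewrite ?mul1r.
rewrite -e => _ [a _ <-]; apply: idealM; first exact: lin_ideal_ideal.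
by rewrite lin_ideal_el.
Qed.

(** Obstructions are indexed by the rational prime below [P], since the sieve runs over rational
    primes. *)
Definition kfree_obstruction k (q : nat) (m : int * int) : Prop :=
  exists P, [/\ prime_ideal P, P q%:R & pow_ideal P k (el w m)].

Lemma not_kfree_obstruction k m : (0 < k)%N -> m != 0 -> ~ kfree k (el w m) ->
  exists2 q, prime q & kfree_obstruction k q m.
Proof.
move=> k0 m0 hk.
have x0 : el w m != 0.
  by apply: contra_neq m0 => e; apply: (el_inj O); rewrite e /el /= mul0r addr0.
have : ~ (forall P, prime_ideal P -> (valuation P (el w m) < k)%N).
  by move=> h; apply: hk.
move=> /existsNP[P /not_implyP[pP]]; rewrite /valuation => /negP; rewrite -leqNgt.
have [s0 hs0] := prime_factorisation_ex O m0.
have := @getPex _ [set i : nat | exists2 s, prime_factorisation (el w m) s &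
  i = count_mem P s] (ex_intro _ _ (ex_intro2 _ _ s0 hs0 erefl)).
move=> [s [hs e] ->] hc.
have ids Q : Q \in s -> ideal Q by move=> /hs/prime_idealP[].
have hx : (\big[@mul_ideal R/[set: R]]_(Q <- s) Q) (el w m).
  by rewrite -e; exists 1; rewrite ?mul1r.
have Ps : P \in s by rewrite -has_pred1 has_count; apply: leq_trans hc.
have [y Py y0] := prod_ideal_neq0 ids hx x0 Ps.
have [q pq Pq] : exists2 q : nat, prime q & P q%:R.
  apply: (prime_ideal_has_prime (z := norm_form t n (coord O y)) pP).
    rewrite -(mul_conj O) (coordK O) mulrC; apply: idealM => //; exact: ids.
  apply: contra_neq y0 => /(norm_form_eq0 O) e'.
  by rewrite -[y](coordK O) e' /el /= mul0r addr0.
exists q => //; exists P; split => //.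
exact: (prod_sub_pow_ideal ids hc).
Qed.

Lemma pow_ideal_dvO (q : int) P k x y : (forall x y, P x -> P y -> dvO q (x * conj y)) ->
  pow_ideal P k x -> pow_ideal P k y -> dvO (q ^+ k) (x * conj y).
Proof.
move=> hP; elim: k x y => [|k IH] x y /=.
  by move=> _ _; exists (x * conj y); rewrite expr0 mul1r.
move=> hx hy; move: x hx.
apply: mul_ideal_min => [|x x'|a x ha hx].
- by rewrite mul0r; exact: dvO0.
- by rewrite mulrDl; apply: dvOD.
- move: y hy.
  apply: mul_ideal_min => [|y y' h h'|b y hb hy].
  + by rewrite (conj0 O) mulr0; exact: dvO0.
  + have -> : a * x * conj (y + y') = a * x * conj y + a * x * conj y'.
      by rewrite (conjD O); ring.
    exact: dvOD.
  + have [u eu] := hP _ _ ha hb; have [v ev] := IH _ _ hx hy.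
    exists (u * v); rewrite (conjM O) exprS intrM.
    have -> : a * x * (conj b * conj y) = (a * conj b) * (x * conj y) by ring.
    rewrite eu ev; ring.
Qed.

Lemma prime_above_dvO q N P x y : prime_above O q N P -> P x -> P y ->
  dvO q (x * conj y).
Proof.
move=> [_ _ [_ /dvdzP[c ec]] [h _] _] hx hy.
have [z ->] := h _ _ hx hy; exists (c%:~R * z); rewrite ec intrM; ring.
Qed.

(** The two sets are the [k]-th powers of a prime over [q] and of its conjugate. They are closed
    under differences, and the product of P^k and its conjugate consists of multiples of q^k. *)
Lemma obstruction_cover k q : prime q -> exists A1 A2 : set (int * int),
  (forall m, kfree_obstruction k q m -> A1 m \/ A2 m) /\
  forall A, A = A1 \/ A = A2 -> A 0 /\
    forall m m', A m -> A m' -> (q%:Z ^+ k %| norm_form t n (m - m'))%Z.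
Proof.
move=> pq; have [N [P hP]] := prime_above_ex O pq.
have hP' := prime_above_conj hP.
exists [set m | pow_ideal P k (el w m)], [set m | pow_ideal (P \o conj) k (el w m)].
split.
  move=> m [Q [pQ Qq hm]].
  by have [h|h] := prime_above_unique hP pQ Qq; [left|right];
    apply: pow_ideal_mono h _ hm.
suff h Q M : prime_above O q M Q -> pow_ideal Q k (el w 0) /\ forall m m',
    pow_ideal Q k (el w m) -> pow_ideal Q k (el w m') ->
    (q%:Z ^+ k %| norm_form t n (m - m'))%Z.
  by move=> A [->|->]; [apply: h hP|apply: h hP'].
move=> hQ; have [/prime_idealP[iQ _ _] _ _ _ _] := hQ.
have ip := pow_ideal_ideal k iQ.
split; first by rewrite /el /= mul0r addr0; case: ip.
move=> m m' hm hm'; apply: (dvO_int O); rewrite -(mul_conj O).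
apply: (@pow_ideal_dvO _ Q); first by move=> *; apply: prime_above_dvO hQ _ _.
  by rewrite elB; apply: idealB.
by rewrite elB; apply: idealB.
Qed.

Lemma obstruction_norm k q m : prime q -> kfree_obstruction k q m ->
  (q%:Z ^+ k %| norm_form t n m)%Z.
Proof.
move=> pq hm; have [A1 [A2 [h hA]]] := obstruction_cover k pq.
rewrite -[m]subr0; case: (h _ hm) => hA1.
  by have [A0 h'] := hA A1 (or_introl erefl); apply: h'.
by have [A0 h'] := hA A2 (or_intror erefl); apply: h'.
Qed.

End KFree.

(** * The ring of integers of a quadratic field *)

Section RingOfIntegers.
Variable d : int.
Hypothesis hd : quadratic_radicand d.
Local Notation s := (sqrtC (d%:~R : algC)).

Lemma sqrt_sqr : s ^+ 2 = d%:~R.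
Proof. by rewrite sqrtCK. Qed.

Lemma sqrt_Aint : s \in Aint.
Proof.
apply: (@root_monic_Aint ('X^2 - (d%:~R)%:P)).
- by rewrite rootE !hornerE sqrt_sqr subrr.
- exact: monicXnsubC.
- by rewrite polyOverXnsubC intr_int.
Qed.

(** Otherwise [s] is a rational algebraic integer, so an integer [z] with [d = z ^+ 2];
    squarefreeness then forces [d = 1]. *)
Lemma sqrt_irrational (a b : rat) : ratr a + ratr b * s = 0 -> a = 0 /\ b = 0.
Proof.
have [sqf d0 d1] := hd.
have [->|b0] := eqVneq b 0.
  rewrite rmorph0 mul0r addr0 => /eqP; rewrite fmorph_eq0 => /eqP ->.
  by [].
move=> e; have es : s = ratr (- a / b).
  rewrite fmorph_div rmorphN /=; apply: (canRL (mulfK _)).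
    by rewrite fmorph_eq0.
  by rewrite mulrC; apply/eqP; rewrite -addr_eq0 addrC e.
have : s \is a Num.int.
  by apply: Cint_rat_Aint sqrt_Aint; rewrite es; apply/CratP; exists (- a / b).
move=> /intrP[z ez].
have ed : d = z ^+ 2.
  by apply: (intr_inj (R := algC)); rewrite -sqrt_sqr ez rmorphXn.
have z1 : `|z|%N = 1%N by apply: sqf; rewrite -ed.
have [zE|zE] : z = 1 \/ z = -1 by lia.
  by case/eqP: d1; rewrite ed zE.
by case/eqP: d1; rewrite ed zE.
Qed.

Lemma sqr_radicand (x y : int) : x ^+ 2 = d * y ^+ 2 -> x = 0 /\ y = 0.
Proof.
move=> e.
have : ((x%:~R : algC) - y%:~R * s) * (x%:~R + y%:~R * s) = 0.
  have -> : ((x%:~R : algC) - y%:~R * s) * (x%:~R + y%:~R * s) =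
    x%:~R ^+ 2 - y%:~R ^+ 2 * s ^+ 2 by ring.
  by rewrite sqrt_sqr -!rmorphXn -intrM -rmorphB /= e mulrC subrr.
have irr (u : int) : (x%:~R : algC) + u%:~R * s = 0 -> x = 0 /\ u = 0.
  move=> h; have [] := @sqrt_irrational x%:~R u%:~R; first by rewrite !ratr_int.
  by move=> /eqP; rewrite intr_eq0 => /eqP -> /eqP; rewrite intr_eq0 => /eqP ->.
move=> /eqP; rewrite mulf_eq0 => /orP[] /eqP; last exact: irr.
by rewrite -mulNr -rmorphN => /irr[-> /eqP]; rewrite oppr_eq0 => /eqP ->.
Qed.

Lemma horner_sqrt (p : {poly rat}) (a b : rat) : exists A B : rat,
  (map_poly ratr p).[ratr a + ratr b * s] = ratr A + ratr B * s /\
  (map_poly ratr p).[ratr a - ratr b * s] = ratr A - ratr B * s.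
Proof.
elim/poly_ind: p => [|p c [A [B [e1 e2]]]].
  by exists 0, 0; rewrite !rmorph0 !horner0 mul0r addr0 subr0.
exists (A * a + B * b * d%:~R + c), (A * b + B * a).
rewrite rmorphD rmorphM /= map_polyX map_polyC /= !hornerMXaddC e1 e2.
have -> : ratr (A * a + B * b * d%:~R + c) =
    ratr A * ratr a + ratr B * ratr b * s ^+ 2 + ratr c :> algC.
  by rewrite !rmorphD !rmorphM /= ratr_int sqrt_sqr.
by rewrite !rmorphD !rmorphM /=; split; ring.
Qed.

(** The minimal polynomial has rational coefficients, so it vanishes at the conjugate as well. *)
Lemma Aint_sqrt_conj (a b : rat) : ratr a + ratr b * s \in Aint ->
  ratr a - ratr b * s \in Aint.
Proof.
set z := _ + _ => Az; have [p [ep pm _]] := minCpolyP z.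
have [A [B [e1 e2]]] := horner_sqrt p a b.
have pz : (map_poly ratr p).[z] = 0.
  by rewrite -ep; apply/eqP; apply: root_minCpoly.
rewrite pz in e1; have [A0 B0] := sqrt_irrational (esym e1).
apply: (@root_monic_Aint (minCpoly z)).
- by rewrite rootE ep e2 A0 B0 !rmorph0 mul0r subr0.
- exact: minCpoly_monic.
- exact: Az.
Qed.

(** The trace [2 * a] and the norm are integers, hence so is [d * (2 * b) ^+ 2]. The squared
    denominator of [2 * b] divides [d], so it is 1. *)
Lemma Aint_coordinates (a b : rat) : ratr a + ratr b * s \in Aint ->
  exists A B : int, [/\ a = A%:~R / 2, b = B%:~R / 2 & (4 %| A ^+ 2 - d * B ^+ 2)%Z].
Proof.
have [sqf d0 d1] := hd.
move=> Az; have Az' := Aint_sqrt_conj Az.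
have intP (c : rat) : (ratr c : algC) \in Aint -> exists z : int, c = z%:~R.
  move=> Ac; have : (ratr c : algC) \is a Num.int.
    by apply: Cint_rat_Aint Ac; apply/CratP; exists c.
  move=> /intrP[z]; rewrite -(ratr_int _ z) => /fmorph_inj; by exists z.
have [A eA] : exists A : int, a * 2 = A%:~R.
  apply: intP; have -> : ratr (a * 2) = (ratr a + ratr b * s) + (ratr a - ratr b * s).
    by rewrite rmorphM /= rmorph_nat; ring.
  exact: rpredD.
have [M eM] : exists M : int, a ^+ 2 - d%:~R * b ^+ 2 = M%:~R.
  apply: intP; have -> : ratr (a ^+ 2 - d%:~R * b ^+ 2) =
      (ratr a + ratr b * s) * (ratr a - ratr b * s).
    by rewrite rmorphB rmorphM !rmorphXn /= ratr_int -[X in X * _]sqrt_sqr; ring.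
  exact: rpredM.
pose c := b * 2; pose E := A ^+ 2 - 4 * M.
have ec : d%:~R * c ^+ 2 = E%:~R :> rat.
  by rewrite /E rmorphB rmorphXn rmorphM /= -eM -eA /c; ring.
have den1 : denq c = 1.
  have e : d * numq c ^+ 2 = E * denq c ^+ 2.
    apply: (intr_inj (R := rat)); rewrite [LHS]rmorphM [RHS]rmorphM !rmorphXn /= -ec.
    by rewrite numqE; ring.
  have cop : coprimez (denq c ^+ 2) (numq c ^+ 2).
    rewrite coprimezE !abszX coprimeXl // coprimeXr // coprime_sym.
    exact: coprime_num_den.
  have : (denq c ^+ 2 %| d)%Z.
    by rewrite -(Gauss_dvdzl _ cop) e dvdz_mull.
  move=> /sqf h; have := denq_gt0 c; lia.
exists A, (numq c).
have eB : (numq c)%:~R = c by rewrite numqE den1 mulr1.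
split.
- by rewrite -eA mulfK.
- by rewrite eB mulfK.
- apply/dvdzP; exists M; apply: (intr_inj (R := rat)).
  by rewrite rmorphB rmorphXn [in LHS]rmorphM rmorphXn [in RHS]rmorphM /= eB -eM -eA /c; ring.
Qed.

Lemma ring_of_integers_val_lin (m : int * int) :
  ring_of_integers_val (m.1%:~R + m.2%:~R * delta d) = m.1%:~R + m.2%:~R * delta_val d.
Proof.
have h (z : int) : ring_of_integers_val (z%:~R : ring_of_integers d) = z%:~R.
  exact: (rmorph_int (\val : ring_of_integers d -> algC)).
by rewrite -!h.
Qed.

Lemma ring_of_integers_valI : injective (@ring_of_integers_val d).
Proof. exact: val_inj. Qed.

Lemma ring_of_integers_lin (x : ring_of_integers d) (m : int * int) :
  ring_of_integers_val x = m.1%:~R + m.2%:~R * delta_val d ->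
  x = m.1%:~R + m.2%:~R * delta d.
Proof. by move=> e; apply: ring_of_integers_valI; rewrite ring_of_integers_val_lin. Qed.

Lemma ring_of_integers_coordinates (x : ring_of_integers d) : exists A B : int,
  ring_of_integers_val x = (A%:~R + B%:~R * s) / 2 /\ (4 %| A ^+ 2 - d * B ^+ 2)%Z.
Proof.
case: x => z hz /=; move: (hz); rewrite unfold_in => /andP[Az /set_mem[a [b ez]]].
rewrite ez in Az; have [A [B [eA eB h]]] := Aint_coordinates Az.
exists A, B; split => //; rewrite ez eA eB !fmorph_div /= !ratr_int rmorph_nat.
by field.
Qed.

Lemma ring_of_integers_order_1mod4 : (d %% 4)%Z = 1 ->
  quadratic_order (delta d) 1 (- (d %/ 4)%Z).
Proof.
move=> d4; have [sqf d0 d1] := hd.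
have ed : d = (d %/ 4)%Z * 4 + 1 by rewrite {1}(divz_eq d 4) d4.
have dv : delta_val d = (1 + s) / 2 by rewrite /delta_val d4 eqxx.
have e4 : (d%:~R : algC) = (d %/ 4)%Z%:~R * 4 + 1 by rewrite {1}ed rmorphD rmorphM.
split.
- apply: ring_of_integers_valI.
  have -> : delta d ^+ 2 = delta d * delta d by [].
  have -> : 1%:~R * delta d - (- (d %/ 4)%Z)%:~R = (d %/ 4)%Z%:~R + 1%:~R * delta d.
    by rewrite rmorphN /= opprK addrC.
  rewrite (ring_of_integers_val_lin ((d %/ 4)%Z, 1)) /=.
  have -> : (d %/ 4)%Z%:~R = (s ^+ 2 - 1) / 4 :> algC.
    by rewrite sqrt_sqr e4; field.
  by rewrite -[LHS]/(delta_val d * delta_val d) dv; field.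
- move=> x; have [A [B [ex h]]] := ring_of_integers_coordinates x.
  have [c ec] : exists c, A - B = 2 * c.
    exists ((A - B) %/ 2)%Z; nia.
  exists (c, B); apply: ring_of_integers_lin; rewrite ex dv /=.
  have -> : A = 2 * c + B by lia.
  by rewrite rmorphD rmorphM /=; field.
- move=> m e; have := ring_of_integers_val_lin m; rewrite e dv.
  rewrite -[LHS]/(0 : algC) => e'.
  have [] := @sqrt_irrational (m.1%:~R + m.2%:~R / 2) (m.2%:~R / 2).
    by rewrite rmorphD !fmorph_div /= !ratr_int rmorph_nat e'; field.
  move: m {e e'} => [a b] /= h1 /eqP.
  rewrite mulf_eq0 invr_eq0 orbF intr_eq0 => /eqP b0; move: h1.
  by rewrite b0 mul0r addr0 => /eqP; rewrite intr_eq0 => /eqP ->.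
- move=> [a b]; rewrite /norm_form /= => e.
  have [|] := @sqr_radicand (2 * a + b) b.
    by rewrite ed; lia.
  by move=> h b0; rewrite b0 in h *; congr (_, _); lia.
(* Here [d] is the discriminant (2r - 1)^2 - 4 f(r), so a violation would give q^2 dividing [d]. *)
- move=> q r pq /dvdzP[c ec] /dvdzP[c' ec'].
  have : `|q%:Z|%N = 1%N.
    apply: sqf; apply/dvdzP; exists (c ^+ 2 - 4 * c').
    have -> : (c ^+ 2 - 4 * c') * q%:Z ^+ 2 = (c * q%:Z) ^+ 2 - 4 * (c' * q%:Z ^+ 2) by ring.
    by rewrite -ec -ec' {1}ed; ring.
  by rewrite absz_nat => q1; rewrite q1 in pq.
Qed.

Lemma ring_of_integers_order_23mod4 : (d %% 4)%Z <> 1 ->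
  quadratic_order (delta d) 0 (- d).
Proof.
move=> d4; have [sqf d0 d1] := hd.
have n4 : ~ (2 ^+ 2 %| d)%Z by move=> /sqf.
have dv : delta_val d = s by rewrite /delta_val; case: eqP.
split.
- apply: ring_of_integers_valI.
  have -> : delta d ^+ 2 = delta d * delta d by [].
  have -> : 0%:~R * delta d - (- d)%:~R = d%:~R + 0%:~R * delta d.
    by rewrite rmorphN /= opprK mul0r add0r addr0.
  rewrite (ring_of_integers_val_lin (d, 0)) /= mul0r addr0.
  by rewrite -[LHS]/(delta_val d * delta_val d) dv -expr2 sqrt_sqr.
- move=> x; have [A [B [ex h]]] := ring_of_integers_coordinates x.
  (* Since [d] is 2 or 3 modulo 4, [A ^+ 2 - d * B ^+ 2] is divisible by 4 only for even [A] and
     [B]. *)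
  have [a [b [ea eb]]] : exists a b, A = 2 * a /\ B = 2 * b.
    have [a [u [eA hu]]] : exists a u : int, A = 2 * a + u /\ (u = 0 \/ u = 1).
      by exists (A %/ 2)%Z, (A %% 2)%Z; lia.
    have [b [v [eB hv]]] : exists b v : int, B = 2 * b + v /\ (v = 0 \/ v = 1).
      by exists (B %/ 2)%Z, (B %% 2)%Z; lia.
    have [f [y [ef hy]]] : exists f y : int, d = 4 * f + y /\ (y = 2 \/ y = 3).
      by exists (d %/ 4)%Z, (d %% 4)%Z; move: n4 d4; lia.
    exists a, b; move/dvdzP: h => [c]; rewrite eA eB ef.
    case: hu hv hy => -> [] -> [] ->; rewrite !expr2; nia.
  exists (a, b); apply: ring_of_integers_lin; rewrite ex dv /= ea eb.
  by rewrite !rmorphM /=; field.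
- move=> m e; have := ring_of_integers_val_lin m; rewrite e dv.
  rewrite -[LHS]/(0 : algC) => e'.
  have [] := @sqrt_irrational m.1%:~R m.2%:~R; first by rewrite !ratr_int.
  by case: m {e e'} => a b /= /eqP; rewrite intr_eq0 => /eqP -> /eqP; rewrite intr_eq0 => /eqP ->.
- move=> [a b]; rewrite /norm_form /= => e.
  have [|-> ->] // := @sqr_radicand a b.
  by apply/eqP; rewrite -subr_eq0 -e; apply/eqP; ring.
- move=> q r pq qr /dvdzP[c ec].
  have ed : d = r ^+ 2 - c * q%:Z ^+ 2 by rewrite -ec; ring.
  (* At [q = 2], an even [r] would give 4 dividing [d] and an odd [r] would give [d] congruent to 1
     modulo 4. An odd [q] divides [r], so q^2 would divide [d]. *)
  have [q2|q2] := eqVneq q 2%N.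
    have [a [u [eA hu]]] : exists a u : int, r = 2 * a + u /\ (u = 0 \/ u = 1).
      by exists (r %/ 2)%Z, (r %% 2)%Z; lia.
    move: ed; rewrite q2 eA => ed.
    case: hu ed => -> ed.
      by case: n4; apply/dvdzP; exists (a ^+ 2 - c); rewrite ed; ring.
    by case: d4; have -> : d = (a ^+ 2 + a - c) * 4 + 1; [rewrite ed; ring|lia].
  have : `|q%:Z|%N = 1%N.
    apply: sqf; rewrite ed; apply: rpredB; last exact: dvdz_mull.
    move: qr; rewrite subr0 => /(prime_dvdzM pq)[|/dvdzP[c' ->]].
      by rewrite dvdzE /= dvdn_prime2 // (negPf q2).
    by rewrite exprMn dvdz_mull.
  by rewrite absz_nat => q1; rewrite q1 in pq.
Qed.

(** The discriminant of f has the sign of [d]; the final contradiction rests on this. *)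
Lemma ring_of_integers_order : exists t n, quadratic_order (delta d) t n /\
  (t ^+ 2 - 4 * n = d \/ t ^+ 2 - 4 * n = 4 * d).
Proof.
have [d4|d4] := eqVneq (d %% 4)%Z 1.
  exists 1, (- (d %/ 4)%Z); split; first exact: ring_of_integers_order_1mod4.
  by left; rewrite [RHS](divz_eq d 4) d4; ring.
exists 0, (- d); split; first by apply/ring_of_integers_order_23mod4/eqP.
by right; ring.
Qed.

End RingOfIntegers.

(** * Split primes and congruences *)

(** Newton iteration, with [u] an inverse of the derivative [2 * r' - t] modulo [q]. The induction
    is on exponents [k.+1], starting from the given root. *)
Lemma hensel_quadratic (t n : int) (q : nat) (r : int) k : prime q ->
  (q%:Z %| r ^+ 2 - t * r + n)%Z -> ~ (q%:Z %| 2 * r - t)%Z ->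
  exists r', (q%:Z ^+ k %| r' ^+ 2 - t * r' + n)%Z /\ ~ (q%:Z %| 2 * r' - t)%Z.
Proof.
move=> pq qf nq; suff [r' [h1 h2 _]] : exists r', [/\
    (q%:Z ^+ k.+1 %| r' ^+ 2 - t * r' + n)%Z,
    ~ (q%:Z %| 2 * r' - t)%Z & (q%:Z %| r' - r)%Z].
  by exists r'; split => //; apply: dvdz_trans h1; rewrite exprS dvdz_mull.
elim: k => [|k [r' [/dvdzP[c ec] h2 h3]]].
  by exists r; split; rewrite ?expr1 ?subrr ?dvdz0.
have [u [v e]] := bezout_prime pq h2.
exists (r' - q%:Z ^+ k.+1 * (u * c)); split.
- have -> : (r' - q%:Z ^+ k.+1 * (u * c)) ^+ 2 - t * (r' - q%:Z ^+ k.+1 * (u * c)) + n =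
    (r' ^+ 2 - t * r' + n) - q%:Z ^+ k.+1 * c * (u * (2 * r' - t))
     + q%:Z ^+ k.+1 * q%:Z ^+ k.+1 * (u * c) ^+ 2 by ring.
  have -> : u * (2 * r' - t) = 1 - v * q%:Z by exact: (canRL (addrK _) e).
  rewrite ec; apply/dvdzP; exists (c * v + q%:Z ^+ k * (u * c) ^+ 2).
  by rewrite !exprS; ring.
- move=> h; apply: h2.
  have -> : 2 * r' - t = (2 * (r' - q%:Z ^+ k.+1 * (u * c)) - t)
    + q%:Z * (2 * q%:Z ^+ k * u * c) by rewrite exprS; ring.
  by apply: rpredD => //; apply: dvdz_mulr.
- have -> : r' - q%:Z ^+ k.+1 * (u * c) - r = (r' - r) - q%:Z * (q%:Z ^+ k * u * c).
    by rewrite exprS; ring.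
  by apply: rpredB => //; apply: dvdz_mulr.
Qed.

(** Euclid's argument: a prime factor of a number congruent to 1 modulo [L!] exceeds [L]. Being
    larger than the discriminant [D], it does not divide [D], so the root is simple and lifts to the
    modulus [q ^ k]. *)
Lemma split_prime_ex (t n : int) (B k : nat) : n != 0 -> t ^+ 2 - 4 * n != 0 ->
  exists q r, [/\ prime q, (B < q)%N, (q%:Z ^+ k %| r ^+ 2 - t * r + n)%Z &
    ~ (q%:Z %| 2 * r - t)%Z].
Proof.
move=> n0 D0; set D := t ^+ 2 - 4 * n in D0.
pose L := (B + `|t| + `|D| + 3)%N.
have [Lt LB LD] : [/\ `|t|%:Z + 3 <= L%:Z, (B <= L)%N & (`|D| <= L)%N].
  by rewrite /L; split; lia.
clearbody L; pose M := (L`!)%:Z.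
have LM : L%:Z <= M by rewrite /M lez_nat; apply: fact_geq.
(* [f (n M) = n (n M^2 - t M + 1)], and the cofactor is prime to [M] *)
pose h := n * M ^+ 2 - t * M + 1.
have h2 : (1 < `|h|)%N.
  rewrite /h; have : `|t|%:Z + 3 <= M by exact: le_trans LM.
  case: (ltgtP n 0) n0 => // hn _ hM; nia.
have pq := pdiv_prime h2; set q := pdiv `|h| in pq.
have qh : (q%:Z %| h)%Z by rewrite dvdzE /= pdiv_dvd.
have qL : (L < q)%N.
  rewrite ltnNge; apply/negP => qL.
  have qM : (q%:Z %| M)%Z.
    by rewrite dvdzE /=; apply: dvdn_fact; rewrite qL prime_gt0.
  have : (q%:Z %| h - M * (n * M - t))%Z by apply: rpredB => //; apply: dvdz_mulr.
  have -> : h - M * (n * M - t) = 1 by rewrite /h; ring.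
  by rewrite dvdz1 absz_nat => /eqP q1; rewrite q1 in pq.
have qf : (q%:Z %| (n * M) ^+ 2 - t * (n * M) + n)%Z.
  have -> : (n * M) ^+ 2 - t * (n * M) + n = n * h by rewrite /h; ring.
  exact: dvdz_mull.
have nq : ~ (q%:Z %| 2 * (n * M) - t)%Z.
  move=> hq; have : (q%:Z %| D)%Z.
    have -> : D = (2 * (n * M) - t) * (2 * (n * M) - t)
      - 4 * ((n * M) ^+ 2 - t * (n * M) + n) by rewrite /D; ring.
    by apply: rpredB; [apply: dvdz_mulr|apply: dvdz_mull].
  rewrite dvdzE absz_nat => /dvdn_leq; rewrite absz_gt0 D0 => /(_ isT).
  by rewrite leqNgt (leq_ltn_trans LD qL).
have [r [h3 h4]] := hensel_quadratic k pq qf nq.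
by exists q, r; split => //; apply: leq_ltn_trans qL.
Qed.

Lemma int_chinese (Q q : int) (a b : int) : coprimez Q q ->
  exists x, (Q %| x - a)%Z /\ (q %| x - b)%Z.
Proof.
move=> /eqP cop; have [u [v e]] := Bezoutz Q q; rewrite cop in e.
exists (a * (v * q) + b * (u * Q)); split.
  have -> : a * (v * q) + b * (u * Q) - a = (b - a) * u * Q + a * (u * Q + v * q - 1).
    by ring.
  by rewrite e subrr mulr0 addr0 dvdz_mull.
have -> : a * (v * q) + b * (u * Q) - b = (a - b) * v * q + b * (u * Q + v * q - 1).
  by ring.
by rewrite e subrr mulr0 addr0 dvdz_mull.
Qed.

(** * Congruences between lattice points and their simultaneous solution *)

Definition congr2 (Q : int) (a b : int * int) : Prop :=
  (Q %| a.1 - b.1)%Z /\ (Q %| a.2 - b.2)%Z.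

Lemma congr2_trans Q a b c : congr2 Q a b -> congr2 Q b c -> congr2 Q a c.
Proof.
move=> [h1 h2] [h3 h4]; split.
  by have := rpredD h1 h3; rewrite addrA subrK.
by have := rpredD h2 h4; rewrite addrA subrK.
Qed.

Lemma congr2_dvd (Q q : int) a b : (q %| Q)%Z -> congr2 Q a b -> congr2 q a b.
Proof. by move=> h [h1 h2]; split; apply: dvdz_trans h _. Qed.

Lemma congr2D Q a b c : congr2 Q a b -> congr2 Q (a + c) (b + c).
Proof. by move=> [h1 h2]; split; rewrite /= opprD addrACA subrr addr0. Qed.

Lemma int_chinese2 (Q q : int) (a b : int * int) : coprimez Q q ->
  exists x, congr2 Q x a /\ congr2 q x b.
Proof.
move=> cop; have [x [h1 h2]] := int_chinese a.1 b.1 cop.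
by have [y [h3 h4]] := int_chinese a.2 b.2 cop; exists (x, y).
Qed.

Lemma norm_form_congr (t n q : int) a b : congr2 q a b ->
  (q %| norm_form t n a)%Z -> (q %| norm_form t n b)%Z.
Proof.
move=> [/dvdzP[c ec] /dvdzP[c' ec']] h.
have -> : norm_form t n b = norm_form t n a -
  q * (c * (a.1 + b.1) + t * c * a.2 + t * c' * b.1 + n * c' * (a.2 + b.2)).
  have -> : b.1 = a.1 - c * q by rewrite -ec; ring.
  have -> : b.2 = a.2 - c' * q by rewrite -ec'; ring.
  rewrite /norm_form /=.
  have -> : b.1 = a.1 - c * q by rewrite -ec; ring.
  have -> : b.2 = a.2 - c' * q by rewrite -ec'; ring.
  ring.
by apply: rpredB => //; apply: dvdz_mulr.
Qed.

Section Congruences.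
Variables (R : comNzRingType) (w : R) (t n : int).
Hypothesis O : quadratic_order w t n.
Local Notation N := (norm_form t n).

Definition residues_avoid (S : seq (int * int)) (Q : nat) (x : int * int) : Prop :=
  forall q, prime q -> (q %| Q)%N -> forall s, s \in S -> ~ (q%:Z %| N (x + s))%Z.

(** Chinese remaindering, one prime at a time. The last clause says that [Q] has no prime factor
    above [B], which keeps the next prime coprime to it. *)
Lemma residues_small_primes (S : seq (int * int)) (B : nat) :
  (forall q, prime q -> (q <= B)%N ->
    exists c, forall s, s \in S -> ~ (q%:Z %| N (c + s))%Z) ->
  exists (Q : nat) (x : int * int), [/\ (0 < Q)%N, residues_avoid S Q x,
    forall q, prime q -> (q <= B)%N -> (q %| Q)%N &
    forall q, prime q -> (q %| Q)%N -> (q <= B)%N].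
Proof.
elim: B => [|B IH] h.
  exists 1%N, 0; split => // q pq; first by rewrite dvdn1 => /eqP q1; rewrite q1 in pq.
    by rewrite leqn0 => /eqP q1; rewrite q1 in pq.
  by rewrite dvdn1 => /eqP q1; rewrite q1 in pq.
have [|Q [x [Q0 av h1 h2]]] := IH.
  by move=> q pq qB; apply: h => //; apply: leqW.
have [pB|nB] := boolP (prime B.+1); last first.
  exists Q, x; split => // q pq.
    rewrite leq_eqVlt => /orP[/eqP e|]; first by rewrite -e pq in nB.
    exact: h1.
  by move=> /(h2 _ pq)/leqW.
have [c hc] := h _ pB (leqnn _).
have cop : coprimez Q%:Z B.+1%:Z.
  rewrite coprimezE !absz_nat coprime_sym prime_coprime //; apply/negP => /(h2 _ pB).
  by rewrite ltnn.
have [y [hy1 hy2]] := int_chinese2 x c cop.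
exists (Q * B.+1)%N, y; split => //.
- by rewrite muln_gt0 Q0.
- move=> q pq; rewrite Euclid_dvdM // => /orP[qQ|].
    move=> s hs hq; apply: (av q pq qQ s hs); apply: norm_form_congr hq.
    by apply: congr2D; apply: congr2_dvd hy1; rewrite dvdzE.
  rewrite dvdn_prime2 // => /eqP -> s hs hq; apply: (hc s hs).
  by apply: norm_form_congr hq; apply: congr2D.
- move=> q pq; rewrite leq_eqVlt => /orP[/eqP ->|]; first exact: dvdn_mull.
  by move=> qB; apply: dvdn_mulr; apply: h1.
- move=> q pq; rewrite Euclid_dvdM // => /orP[/(h2 _ pq)/leqW //|].
  by apply: dvdn_leq.
Qed.

(** Up to sign these are the norms of [w] and of [2 * w - t]. *)
Lemma gen_norm_neq0 : n != 0 /\ t ^+ 2 - 4 * n != 0.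
Proof.
split; apply/eqP => e.
  have : ((0, 1) : int * int) = 0.
    by apply: (norm_form_eq0 O); rewrite /norm_form /= e; ring.
  by [].
have : ((- t, 2) : int * int) = 0.
  apply: (norm_form_eq0 O); rewrite /norm_form /=.
  by rewrite -[RHS]oppr0 -e; ring.
by [].
Qed.

(** Each [v] of [W] outside [S] gets its own split prime [q], and [y] is made congruent to [- v]
    modulo [q ^ k]; then [y + v] lies in the [k]-th power of a prime over [q]. *)
Lemma residues_holes (S W : seq (int * int)) (Q : nat) x k : (0 < k)%N ->
  (0 < Q)%N -> residues_avoid S Q x ->
  exists (Q' : nat) (x' : int * int), [/\ (0 < Q')%N, (Q %| Q')%N,
    residues_avoid S Q' x' &
    forall v, v \in W -> v \notin S ->
      forall y, congr2 Q'%:Z y x' -> ~ kfree k (el w (y + v))].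
Proof.
move=> k0 Q0 av; elim: W => [|v W [Q' [x' [Q'0 QQ' av' h]]]].
  by exists Q, x; split.
have [vS|vS] := boolP (v \in S).
  exists Q', x'; split => // v'; rewrite inE => /orP[/eqP ->|]; last exact: h.
  by rewrite vS.
have [n0 D0] := gen_norm_neq0.
(* [q] exceeds [Q'], so it is coprime to it, and exceeds every nonzero norm of [s - v], so the new
   congruence keeps the norms at [S] prime to [q]. *)
have [q [r [pq qB qf nq]]] :=
  split_prime_ex (Q' + \sum_(s <- S) `|N (s - v)%R|)%N k n0 D0.
have cop : coprimez Q'%:Z (q%:Z ^+ k).
  rewrite coprimezE abszX !absz_nat coprime_sym coprimeXl // prime_coprime //.
  by apply/negP => /(dvdn_leq Q'0); rewrite leqNgt (leq_ltn_trans (leq_addr _ _) qB).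
have [y [hy1 hy2]] := int_chinese2 x' (- v) cop.
have qk : (q%:Z %| q%:Z ^+ k)%Z by case: (k) k0 => // k' _; rewrite exprS dvdz_mulr.
exists (Q' * q ^ k)%N, y; split.
- by rewrite muln_gt0 Q'0 expn_gt0 prime_gt0.
- exact: dvdn_mulr.
- move=> q' pq'; rewrite Euclid_dvdM // => /orP[qQ|].
    move=> s hs hq; apply: (av' q' pq' qQ s hs); apply: norm_form_congr hq.
    by apply: congr2D; apply: congr2_dvd hy1; rewrite dvdzE.
  rewrite Euclid_dvdX // dvdn_prime2 // => /andP[/eqP -> _] s hs hq.
  have : (q%:Z %| N (s - v))%Z.
    apply: norm_form_congr hq; rewrite [s - v]addrC; apply: congr2D.
    exact: congr2_dvd hy2.
  rewrite dvdzE absz_nat => /dvdn_leq; rewrite absz_gt0.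
  have sv : N (s - v) != 0.
    apply/eqP => /(norm_form_eq0 O)/eqP; rewrite subr_eq0 => /eqP e.
    by rewrite -e hs in vS.
  move=> /(_ sv); rewrite leqNgt (leq_ltn_trans _ qB) //.
  by apply: leq_trans (leq_addl _ _); rewrite (big_rem s) //= leq_addr.
- move=> v'; rewrite inE => /orP[/eqP -> _|hv' nv'] z hz.
    have [h1 h2] : congr2 (q%:Z ^+ k) z (- v).
      apply: congr2_trans hy2; apply: congr2_dvd hz.
      by rewrite dvdzE abszX !absz_nat dvdn_mull.
    apply: (lin_ideal_not_kfree O pq qf nq k0) => /=.
    move: h1 h2; rewrite /= !opprK => h1 h2.
    by apply: rpredD => //; apply: dvdz_mulr.
  apply: (h v' hv' nv'); apply: congr2_trans hy1; apply: congr2_dvd hz.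
  by rewrite dvdzE !absz_nat dvdn_mulr.
Qed.

End Congruences.

(** * The sieve *)

Lemma card_le_cover (T : finType) (I : eqType) (A : {set T}) (F : I -> {set T})
    (r : seq I) :
  (forall u, u \in A -> exists2 i, i \in r & u \in F i) ->
  (#|A| <= \sum_(i <- r) #|F i|)%N.
Proof.
elim: r A => [|i r IH] A h.
  rewrite big_nil leqn0 cards_eq0; apply/eqP/setP => u; rewrite finset.in_set0.
  by apply/negP => /h[].
rewrite big_cons; apply: (@leq_trans (#|F i| + #|A :\: F i|)%N).
  rewrite -(cardsID (F i) A) leq_add2r; by apply/subset_leq_card/finset.subsetIr.
rewrite leq_add2l; apply: IH => u; rewrite finset.in_setD => /andP[nu /h[j]].
by rewrite inE => /orP[/eqP -> uF|]; [rewrite uF in nu|exists j].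
Qed.

Lemma card_le_cells (N a : nat) (A : {set 'I_N * 'I_N}) :
  (forall u v, u \in A -> v \in A ->
     (u.1 %/ a = v.1 %/ a -> u.2 %/ a = v.2 %/ a -> u = v)%N) ->
  (#|A| <= (N %/ a).+1 ^ 2)%N.
Proof.
move=> h; pose f (u : 'I_N * 'I_N) : 'I_(N %/ a).+1 * 'I_(N %/ a).+1 :=
  (inord (u.1 %/ a), inord (u.2 %/ a)).
have fi : {in A &, injective f}.
  move=> u v hu hv [/(congr1 val) e1 /(congr1 val) e2].
  move: e1 e2; rewrite /= !inordK ?ltnS ?leq_div2r // 1?ltnW //.
  exact: h.
rewrite -(card_in_imset fi); apply: leq_trans (max_card _) _.
by rewrite card_prod !card_ord -mulnn.
Qed.

Lemma norm_form_bound (t n : int) (m : int * int) (X : nat) :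
  (`|m.1| <= X)%N -> (`|m.2| <= X)%N ->
  (`|norm_form t n m| <= (1 + `|t| + `|n|) * X ^ 2)%N.
Proof.
case: m => a b /= ha hb; rewrite /norm_form /=.
apply: (@leq_trans (`|a| * `|a| + `|t| * (`|a| * `|b|) + `|n| * (`|b| * `|b|))%N).
  rewrite -!abszM mulrA !expr2; lia.
rewrite !mulnDl mul1n -mulnn; apply: leq_add; first apply: leq_add.
- exact: leq_mul.
- by rewrite leq_mul2l leq_mul ?orbT.
- by rewrite leq_mul2l leq_mul ?orbT.
Qed.

(** With [K] the quotient of [N] by the cell side, K q <= 2 C N and 2 (K + 1)^2 <= 4 K^2 + 4. *)
Lemma cell_count_bound (C N q : nat) : (0 < C)%N -> (C <= q)%N ->
  ((2 * (N %/ (q %/ C)).+1 ^ 2)%:R : rat) <= (16 * C ^ 2 * N ^ 2)%:R / (q ^ 2)%:R + 4%:R.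
Proof.
move=> C0 Cq; set a := (q %/ C)%N; set K := (N %/ a)%N.
have a0 : (0 < a)%N by rewrite divn_gt0.
have qa : (q <= 2 * C * a)%N.
  have := ltn_ceil q C0; rewrite -/a => /ltnW h; apply: leq_trans h _.
  by rewrite mulnAC leq_mul2r; apply/orP; right; lia.
have Ka : (K * a <= N)%N by apply: leq_trunc_div.
have Kq : (K * q <= 2 * C * N)%N.
  apply: leq_trans (leq_mul (leqnn K) qa) _.
  by rewrite mulnCA leq_mul2l Ka orbT.
have q0 : (0 < q ^ 2)%N by rewrite expn_gt0 (leq_trans C0 Cq).
have q0' : 0 < (q ^ 2)%:R :> rat by rewrite ltr0n.
rewrite -(ler_pM2r q0') mulrDl mulfVK ?gt_eqF // -!natrM -natrD ler_nat.
have : ((K * q) ^ 2 <= (2 * C * N) ^ 2)%N by rewrite leq_exp2r.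
have -> : (2 * K.+1 ^ 2 * q ^ 2 = 2 * (K * q + q) ^ 2)%N.
  by rewrite -mulnA -expnMn (mulSnr K q).
have -> : (16 * C ^ 2 * N ^ 2 = 4 * (2 * C * N) ^ 2)%N by rewrite !expnMn; lia.
move: (K * q)%N (2 * C * N)%N => A X h; have := (nat_Cauchy A q).1; rewrite sqrnD; lia.
Qed.

(** Telescoping, as 1/(x + 1)^2 <= 1/x - 1/(x + 1). *)
Lemma sum_inv_sqr (B Z : nat) : (0 < B)%N ->
  \sum_(B.+1 <= q < (B + Z).+1) ((q ^ 2)%:R : rat)^-1 <= B%:R^-1 - (B + Z)%:R^-1.
Proof.
move=> B0; elim: Z => [|Z IH]; first by rewrite addn0 big_geq // subrr.
rewrite addnS big_nat_recr /=; last by rewrite ltnS leq_addr.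
apply: le_trans (lerD IH (lexx _)) _.
rewrite -addrA lerD2l; set x := (B + Z)%N.
have x0 : 0 < x%:R :> rat by rewrite ltr0n addn_gt0 B0.
have x1 : 0 < (x.+1)%:R :> rat by rewrite ltr0n.
rewrite natrX -subr_ge0.
have -> : - (x.+1)%:R^-1 - (- x%:R^-1 + ((x.+1)%:R ^+ 2)^-1) =
    (x%:R * (x.+1)%:R ^+ 2)^-1 :> rat.
  have e : (x.+1)%:R = x%:R + 1 :> rat by rewrite natr1.
  rewrite e; rewrite e in x1; field.
  by rewrite !gt_eqF.
by rewrite invr_ge0 mulr_ge0 ?exprn_ge0 // ltW.
Qed.

Lemma dist_same_cell (a i j : nat) : (0 < a)%N -> (i %/ a = j %/ a)%N ->
  (`|(i%:Z - j%:Z)%R| <= a - 1)%N.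
Proof.
move=> a0 e; rewrite (divn_eq i a) (divn_eq j a) e.
have := ltn_pmod i a0; have := ltn_pmod j a0.
move: (i %% a)%N (j %% a)%N (j %/ a * a)%N => {e}; lia.
Qed.

Lemma shift_bound (z : int) (Q N i X : nat) : (`|z| <= X)%N -> (i < N)%N ->
  (`|(z + Q%:Z * i%:Z)%R| <= X + Q * N)%N.
Proof.
move=> zX iN; have : (Q * i <= Q * N)%N by rewrite leq_mul2l ltnW ?orbT.
move: (Q * N)%N => M; rewrite -PoszM; move: (Q * i)%N; lia.
Qed.

Lemma sum_le_size (I : eqType) (r : seq I) (F : I -> rat) (X : rat) :
  (forall i, i \in r -> F i <= X) -> \sum_(i <- r) F i <= X * (size r)%:R.
Proof.
elim: r => [|i r IH] h /=; first by rewrite big_nil mulr0.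
rewrite big_cons -nat1r mulrDr mulr1; apply: lerD; first by apply: h; rewrite inE eqxx.
by apply: IH => j jr; apply: h; rewrite inE jr orbT.
Qed.

Section Sieve.
Variables (R : comNzRingType) (w : R) (t n : int).
Hypothesis O : quadratic_order w t n.
Let C := (1 + `|t| + `|n|)%N.

Definition grid_point (Q : nat) (x : int * int) N (u : 'I_N * 'I_N) : int * int :=
  x + (Q%:Z * u.1%:Z, Q%:Z * u.2%:Z).

(* Two points of the grid lying in one of the (at most two) [k]-th prime powers
   over [q] differ by an element of norm divisible by [q ^ k], so a square cell of
   side [q / C] contains at most one point of each. *)
Lemma obstruction_count k N Q q x : (2 <= k)%N -> prime q -> ~~ (q %| Q)%N ->
  (C <= q)%N ->
  (#|finset (fun u : 'I_N * 'I_N => `[< kfree_obstruction w k q (grid_point Q x u) >])|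
     <= 2 * (N %/ (q %/ C)).+1 ^ 2)%N.
Proof.
move=> k2 pq qQ Cq; set a := (q %/ C)%N.
have a0 : (0 < a)%N by rewrite divn_gt0.
have Ca : (C * (a - 1) ^ 2 < q ^ 2)%N.
  have h : (C * a <= q)%N by rewrite mulnC leq_trunc_div.
  have C1 : (0 < C)%N by [].
  apply: (@leq_ltn_trans ((C * (a - 1)) ^ 2)%N).
    by rewrite expnMn leq_mul2r -mulnn leq_pmulr // orbT.
  rewrite ltn_sqr; apply: leq_trans h; rewrite ltn_pmul2l //.
  by rewrite subn1 prednK.
have [A1 [A2 [hA hA']]] := obstruction_cover O k pq.
pose F (A : set (int * int)) := finset (fun u : 'I_N * 'I_N => `[< A (grid_point Q x u) >]).
have FA A : A = A1 \/ A = A2 -> (#|F A| <= (N %/ a).+1 ^ 2)%N.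
  move=> eA; have [_ hd] := hA' A eA.
  apply: card_le_cells => u v; rewrite !finset.inE => /asboolP hu /asboolP hv e1 e2.
  have := hd _ _ hu hv.
  pose m : int * int := (u.1%:Z - v.1%:Z, u.2%:Z - v.2%:Z).
  have -> : norm_form t n (grid_point Q x u - grid_point Q x v) =
      Q%:Z ^+ 2 * norm_form t n m.
    by rewrite /norm_form /=; ring.
  rewrite Gauss_dvdzr; last first.
    rewrite coprimezE !abszX !absz_nat coprimeXl // coprimeXr // prime_coprime //.
  move=> qm; suff : norm_form t n m = 0.
    move/(norm_form_eq0 O) => [/eqP + /eqP]; rewrite !subr_eq0 => /eqP [e3] /eqP [e4].
    by case: (u) (v) e3 e4 => [? ?] [? ?] /= /val_inj -> /val_inj ->.
  apply/eqP; rewrite -absz_eq0; apply/negPn/negP => nz.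
  have hX (i j : nat) : (i %/ a = j %/ a)%N -> (`|(i%:Z - j%:Z)%R| <= a - 1)%N.
    exact: dist_same_cell.
  have := norm_form_bound t n (hX _ _ e1 : (`|m.1| <= _)%N) (hX _ _ e2 : (`|m.2| <= _)%N).
  apply/negP; rewrite -ltnNge; apply: (leq_trans Ca).
  apply: (@leq_trans (q ^ k)%N); first by rewrite leq_pexp2l // prime_gt0.
  by move: qm; rewrite dvdzE abszX absz_nat => /dvdn_leq; apply; rewrite lt0n.
apply: (@leq_trans (\sum_(A <- [:: A1; A2]) #|F A|)%N).
  apply: card_le_cover => u; rewrite !finset.inE => /asboolP /hA[] h.
    by exists A1; rewrite ?inE ?eqxx // finset.inE; apply/asboolP.
  by exists A2; rewrite ?inE ?eqxx ?orbT // finset.inE; apply/asboolP.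
rewrite !big_cons big_nil addn0 mul2n -addnn.
by apply: leq_add; apply: FA; [left|right].
Qed.

(** Chosen so that the main term 16 C^2 N^2 / B of the sieve becomes N^2 / (4 (sz + 1)): summed over
    [sz] points it stays below a quarter of the grid. *)
Definition sieve_level (sz : nat) : nat := (64 * C ^ 2 * sz.+1)%N.

(** Only primes above [B] can obstruct, since smaller ones divide [Q] and [Q] is prime to all the
    norms. The inverse squares sum to at most 1/B, and the 4 allowed per prime adds an error linear
    in [N]. *)
Lemma not_kfree_count k N Q (S : seq (int * int)) x s B Rx : (2 <= k)%N ->
  (C <= B)%N -> (2 <= B)%N ->
  residues_avoid t n S Q x -> (forall q, prime q -> (q <= B)%N -> (q %| Q)%N) ->
  s \in S -> (`|(x.1 + s.1)%R| <= Rx)%N -> (`|(x.2 + s.2)%R| <= Rx)%N ->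
  (#|finset (fun u : 'I_N * 'I_N => `[< ~ kfree k (el w (grid_point Q (x + s)%R u)) >])|%:R
   : rat) <= (16 * C ^ 2 * N ^ 2)%:R / B%:R + (4 * (C * (Rx + Q * N)))%:R.
Proof.
move=> k2 CB B2 av hB sS hx1 hx2; set Z := (C * (Rx + Q * N))%N.
pose E q := if prime q && ~~ (q %| Q)%N then
  finset (fun u : 'I_N * 'I_N => `[< kfree_obstruction w k q (grid_point Q (x + s)%R u) >])
  else finset (fun=> false).
have hE : (#|finset (fun u : 'I_N * 'I_N =>
      `[< ~ kfree k (el w (grid_point Q (x + s)%R u)) >])|
    <= \sum_(q <- index_iota B.+1 (B + Z).+1) #|E q|)%N.
  apply: card_le_cover => u; rewrite finset.inE => /asboolP hu.
  set m := grid_point Q (x + s)%R u in hu.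
  have avm q : prime q -> (q %| Q)%N -> ~ (q%:Z %| norm_form t n m)%Z.
    move=> pq qQ hq; apply: (av q pq qQ s sS); apply: norm_form_congr hq.
    by split; rewrite /m /= addrAC subrr add0r; apply: dvdz_mulr; rewrite dvdzE.
  have m0 : m != 0.
    apply/eqP => m0; apply: (avm 2%N) => //; first exact: hB.
    have -> : norm_form t n m = 0 by rewrite m0 /norm_form /=; ring.
    exact: dvdz0.
  have [q pq hq] := not_kfree_obstruction O (ltnW k2) m0 hu.
  have qk := obstruction_norm O pq hq.
  have nqQ : ~~ (q %| Q)%N.
    apply/negP => qQ; apply: (avm q pq qQ); apply: dvdz_trans qk.
    by case: (k) k2 => // k' _; rewrite exprS dvdz_mulr.
  exists q; last first.
    by rewrite /E pq nqQ finset.inE; apply/asboolP.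
  rewrite mem_index_iota ltnS; apply/andP; split.
    by rewrite ltnNge; apply/negP => /(hB _ pq); apply/negP.
  apply: leq_trans (leq_addl _ _).
  (* q^2 <= q^k <= |norm of m| <= C (Rx + Q N)^2 <= Z^2; here [2 <= k] makes the range of primes
     linear in [N]. *)
  rewrite -leq_sqr; apply: (@leq_trans (q ^ k)%N).
    by rewrite leq_pexp2l // prime_gt0.
  apply: (@leq_trans (C * (Rx + Q * N) ^ 2)%N); last first.
    by rewrite /Z expnMn leq_mul2r -mulnn leq_pmulr // orbT.
  apply: (@leq_trans `|norm_form t n m|%N).
    move: qk; rewrite dvdzE abszX absz_nat => /dvdn_leq; apply.
    by rewrite absz_gt0; apply: contra_neq m0; apply: (norm_form_eq0 O).
  by apply: norm_form_bound; rewrite /m /=; apply: shift_bound.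
apply: (@le_trans _ _ (\sum_(B.+1 <= q < (B + Z).+1) #|E q|)%N%:R); first by rewrite ler_nat.
rewrite natr_sum.
apply: (@le_trans _ _ (\sum_(B.+1 <= q < (B + Z).+1)
    ((16 * C ^ 2 * N ^ 2)%:R / (q ^ 2)%:R + 4%:R))).
  rewrite !big_seq; apply: ler_sum => q; rewrite mem_index_iota => /andP[Bq _].
  have Cq : (C <= q)%N by apply: leq_trans CB (ltnW Bq).
  apply: le_trans (cell_count_bound N (isT : (0 < C)%N) Cq).
  rewrite ler_nat /E; case: ifP => [/andP[pq nqQ]|_]; first exact: obstruction_count.
  by rewrite (_ : finset _ = finset.set0) ?cards0 //; apply/setP => u; rewrite !finset.inE.
rewrite big_split /= -mulr_sumr sumr_const_nat subSS addKn; apply: lerD.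
  apply: ler_wpM2l => //; apply: le_trans (sum_inv_sqr Z (ltnW B2)) _.
  by rewrite gerBl invr_ge0.
by rewrite natrM mulr_natr.
Qed.

Lemma kfree_sieve k sz Q (S : seq (int * int)) x : (2 <= k)%N -> (size S <= sz)%N ->
  residues_avoid t n S Q x ->
  (forall q, prime q -> (q <= sieve_level sz)%N -> (q %| Q)%N) ->
  exists y, congr2 Q%:Z y x /\ forall s, s \in S -> kfree k (el w (y + s)).
Proof.
move=> k2 hS av hQ.
have C1 : (0 < C)%N by [].
have CB : (C <= sieve_level sz)%N.
  by rewrite /sieve_level -mulnn mulnCA -mulnA leq_pmulr // !muln_gt0 C1.
pose Rx := (\sum_(s <- S) (`|(x.1 + s.1)%R| + `|(x.2 + s.2)%R|))%N.
have hRx s : s \in S -> (`|(x.1 + s.1)%R| <= Rx)%N /\ (`|(x.2 + s.2)%R| <= Rx)%N.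
  move=> sS; rewrite /Rx (big_rem s) //=; split.
    by rewrite -addnA leq_addr.
  by rewrite addnAC leq_addl.
(* Large enough for the linear errors of all [sz] points to total at most a quarter of N^2. At most
   half of the grid is then bad. *)
pose N := (16 * sz * C * (Rx + Q)).+1.
case: (pselect (exists u : 'I_N * 'I_N, forall s, s \in S ->
    kfree k (el w (grid_point Q (x + s)%R u)))) => [[u hu]|no].
  exists (grid_point Q x u); split.
    by split; rewrite /= addrC addKr; apply: dvdz_mulr; rewrite dvdzE.
  by move=> s /hu; rewrite /grid_point addrAC.
pose F s := finset (fun u : 'I_N * 'I_N => `[< ~ kfree k (el w (grid_point Q (x + s)%R u)) >]).
have : (#|[set: 'I_N * 'I_N]%SET| <= \sum_(s <- S) #|F s|)%N.
  apply: card_le_cover => u _; apply: contrapT => h; apply: no; exists u => s sS.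
  by apply: contrapT => nk; apply: h; exists s => //; rewrite finset.inE; apply/asboolP.
rewrite cardsT card_prod card_ord leqNgt => /negP[].
rewrite -(ltr_nat rat) natr_sum.
have hF s : s \in S -> (#|F s|%:R : rat) <=
    (16 * C ^ 2 * N ^ 2)%:R / (sieve_level sz)%:R + (4 * (C * (Rx + Q * N)))%:R.
  move=> sS; have [h1 h2] := hRx s sS; apply: not_kfree_count av hQ sS h1 h2 => //.
  by apply: leq_trans (_ : 64 <= _)%N => //; rewrite /sieve_level -mulnA leq_pmulr // muln_gt0 expn_gt0 C1.
apply: (@le_lt_trans _ _ (((N ^ 2)%:R / (4 * sz.+1)%:R +
    (4 * (C * (Rx + Q * N)))%:R) * (size S)%:R)).
  apply: sum_le_size => s sS; apply: le_trans (hF s sS) _.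
  rewrite lerD2r /sieve_level.
  have c0 : (C%:R : rat) != 0 by rewrite pnatr_eq0 -lt0n.
  have z0 : (sz.+1%:R : rat) != 0 by rewrite pnatr_eq0.
  rewrite -!mulnn !natrM le_eqVlt; apply/orP; left; apply/eqP; field.
  by rewrite nat1r z0 c0.
set a := _ / _; set b := (4 * _)%N; set M : rat := (N * N)%:R.
have a0 : 0 <= a by rewrite divr_ge0.
have M0 : 0 < M by rewrite ltr0n muln_gt0.
have hb : 4 * (b%:R * sz%:R) <= M.
  rewrite -!natrM ler_nat.
  have h : (Rx + Q * N <= (Rx + Q) * N)%N by rewrite mulnDl leq_add2r leq_pmulr.
  apply: (@leq_trans (16 * sz * C * (Rx + Q) * N)%N); last first.
    by rewrite leq_mul2r leqnSn orbT.
  have -> : (4 * (b * sz) = 16 * sz * C * (Rx + Q * N))%N by rewrite /b; ring.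
  by rewrite -[leqRHS]mulnA leq_mul2l h orbT.
have ha : 4 * (a * sz%:R) <= M.
  have -> : M = 4 * (a * sz.+1%:R).
    rewrite /a /M -mulnn !natrM; field.
    by rewrite nat1r pnatr_eq0.
  by rewrite ler_pM2l // ler_wpM2l // ler_nat.
apply: (@le_lt_trans _ _ ((a + b%:R) * sz%:R)).
  by rewrite ler_wpM2l ?ler_nat // addr_ge0.
rewrite mulrDl; lra.
Qed.

End Sieve.

(** * Realising finite patterns exactly on a window *)

Section Realization.
Variables (R : comNzRingType) (w : R) (t n : int).
Hypothesis O : quadratic_order w t n.

Lemma kfree_realization k sz (S W : seq (int * int)) : (2 <= k)%N -> (size S <= sz)%N ->
  (forall q, prime q -> (q <= sieve_level t n sz)%N ->
    exists c, forall s, s \in S -> ~ (q%:Z %| norm_form t n (c + s))%Z) ->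
  exists y, (forall s, s \in S -> kfree k (el w (y + s))) /\
    forall v, v \in W -> v \notin S -> ~ kfree k (el w (y + v)).
Proof.
move=> k2 hS hc; have k0 : (0 < k)%N by apply: ltnW.
have [Q [x [Q0 av hQ _]]] := residues_small_primes hc.
have [Q' [x' [Q'0 QQ' av' hW]]] := residues_holes O W k0 Q0 av.
have [|y [hy hyS]] := kfree_sieve O k2 hS av'.
  by move=> q pq qB; apply: dvdn_trans QQ'; apply: hQ.
by exists y; split => // v vW vS; apply: hW hy.
Qed.

End Realization.

(** * The shifts and their conjugacies *)

Definition cylinder (x : config) (W : seq (int * int)) : set config :=
  [set y | forall m, m \in W -> y m = x m].

Lemma nbhs_cylinderP (x : config) (A : set config) :
  nbhs x A <-> exists W, cylinder x W `<=` A.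
Proof.
split=> [|[W]]; last first.
  move=> /filterS; apply; elim: W => [|m W IH].
    by apply: filterS filterT => y _ m; rewrite in_nil.
  have h : nbhs x [set y : config | y m = x m].
    exact: (@proj_continuous (int * int)%type (fun=> bool : topologicalType) m x
      [set x m] (discrete_set1 _)).
  apply: filterS2 h IH => y /= e h m'; rewrite inE => /orP[/eqP ->|] //.
  exact: h.
pose F : set_system config := filter_from [set: seq (int * int)] (cylinder x).
have FF : Filter F.
  apply: filter_from_filter; first by exists [::].
  move=> W W' _ _; exists (W ++ W') => // y hy; split=> m hm; apply: hy;
    by rewrite mem_cat hm ?orbT.
have Fx : F --> x.
  apply/cvg_sup => m U [V] [[D] oD <-] Dx DU; apply: (filterS DU).
  by exists [:: m] => // y hy; rewrite /= hy // mem_head.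
by move=> /Fx[W _ hW]; exists W.
Qed.

Lemma PoszXn (q l : nat) : (q ^ l)%N%:Z = q%:Z ^+ l.
Proof. by rewrite -natz natrX natz. Qed.

(** With its converse [kfree_shift_intro], this turns the orbit closure into a statement about
    finite windows. *)
Lemma kfree_shift_cylinder d k (x : config) (W : seq (int * int)) : kfree_shift d k x ->
  exists y, forall m, m \in W -> x m = `[< kfree k (el (delta d) (y + m)) >].
Proof.
move=> hx; have /hx[_ [[z _ <-] hz]] : nbhs x (cylinder x W).
  by apply/nbhs_cylinderP; exists W.
exists (- z) => m mW; rewrite -(hz m mW) /translate /indicator addrC.
by apply/idP/asboolP => [/set_mem|h] //; apply/mem_set.
Qed.

Lemma kfree_shift_intro d k (x : config) :
  (forall W : seq (int * int), exists y, forall m, m \in W ->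
     x m = `[< kfree k (el (delta d) (y + m)) >]) -> kfree_shift d k x.
Proof.
move=> h A /nbhs_cylinderP[W hW]; have [y hy] := h W.
exists (translate (- y) (indicator (kfree_points d k))); split; first by exists (- y).
apply: hW => m mW; rewrite (hy _ mW) /translate /indicator opprK addrC.
by apply/idP/asboolP => [/set_mem|h'] //; apply/mem_set.
Qed.

Definition finite_config (S : seq (int * int)) : config := fun m => m \in S.

Lemma finite_config_kfree_shift d t n k (S : seq (int * int)) :
  quadratic_order (delta d) t n -> (2 <= k)%N ->
  (forall q, prime q -> (q <= sieve_level t n (size S))%N ->
    exists c, forall s, s \in S -> ~ (q%:Z %| norm_form t n (c + s))%Z) ->
  kfree_shift d k (finite_config S).
Proof.
move=> O k2 hS; apply: kfree_shift_intro => W.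
have [y [h1 h2]] := kfree_realization O W k2 (leqnn _) hS.
exists y => m mW; rewrite /finite_config; apply/idP/asboolP; first exact: h1.
by move=> hm; apply: contraT => /(h2 m mW).
Qed.

(** A row of [q ^ l] consecutive points meets every coset of [lin_ideal (q ^ l) r], in particular
    the one that is never [l]-free. *)
Lemma kfree_shift_false e t n l (y : config) : quadratic_order (delta e) t n ->
  (0 < l)%N -> kfree_shift e l y -> exists m, y m = false.
Proof.
move=> O l0 hy; have [n0 D0] := gen_norm_neq0 O.
have [q [r [pq _ qf nq]]] := split_prime_ex 0 l n0 D0.
pose W : seq (int * int) := [seq (Posz i, 0) | i <- iota 0 (q ^ l)].
have [z hz] := kfree_shift_cylinder W hy.
have ql0 : 0 < q%:Z ^+ l by rewrite exprn_gt0 // ltz_nat prime_gt0.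
pose u := z.1 + z.2 * r; pose i := ((- u) %% (q%:Z ^+ l))%Z.
have i0 : 0 <= i by rewrite modz_ge0 // gt_eqF.
have iW : (i, 0) \in W.
  apply/mapP; exists `|i|%N; last by rewrite gez0_abs.
  by rewrite mem_iota add0n leq0n /= -ltz_nat gez0_abs // PoszXn ltz_pmod.
exists (i, 0); rewrite (hz _ iW); apply/asboolPn.
apply: (lin_ideal_not_kfree O pq qf nq l0) => /=.
have -> : z.1 + i + (z.2 + 0) * r = i - (- u) by rewrite /u; ring.
by rewrite -eqz_mod_dvd modz_mod.
Qed.

(** * What a conjugacy does to sparse configurations *)

Lemma within_continuous_config (X : set config) (f : config -> config) x a :
  {within X, continuous f} -> X x ->
  exists W : seq (int * int), forall y, X y -> cylinder x W y -> f y a = f x a.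
Proof.
move=> cf Xx; have h : nbhs (f x) (cylinder (f x) [:: a]).
  by apply/nbhs_cylinderP; exists [:: a].
have : nbhs_subspace (A := X) x (f @^-1` cylinder (f x) [:: a]) := cf x _ h.
rewrite -(nbhs_subspace_in Xx) => /nbhs_cylinderP[W hW].
by exists W => y Xy hy; apply: (hW y hy Xy); rewrite mem_head.
Qed.

(** [a] is a site occupied in the image of a single point, and [W] a window on which agreement with
    that point fixes the image at [a]. *)
Lemma conjugate_sparse d e t n t' n' k l : (2 <= k)%N -> (0 < l)%N ->
  quadratic_order (delta d) t n -> quadratic_order (delta e) t' n' ->
  topologically_conjugate (kfree_shift d k) (kfree_shift e l) ->
  exists (a : int * int) (W : seq (int * int)), forall S : seq (int * int),
    kfree_shift d k (finite_config S) ->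
    (forall s s', s \in S -> s' \in S -> s' - s \in W -> s' = s) ->
    exists2 y, kfree_shift e l y & forall s, s \in S -> y (s + a).
Proof.
move=> k2 l0 O O' [f [g [[fXY _ fK _] [cf _ feq]]]].
set X := kfree_shift d k in fXY fK cf feq *.
set Y := kfree_shift e l in fXY *.
have X0 : X (finite_config [::]).
  by apply: (finite_config_kfree_shift O) => // q _ _; exists 0.
have X1 : X (finite_config [:: 0]).
  apply: (finite_config_kfree_shift O) => // q pq _; exists (1, 0) => s.
  rewrite inE => /eqP ->; rewrite addr0.
  have -> : norm_form t n (1, 0) = 1 by rewrite /norm_form /=; ring.
  by rewrite dvdz1 absz_nat => /eqP q1; rewrite q1 in pq.
(* By equivariance the image of the empty configuration is constant, and it has a [false] entry. *)
have f0 m : f (finite_config [::]) m = false.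
  have [m' fm'] := kfree_shift_false O' l0 (fXY _ X0).
  rewrite -fm'; have := feq (m - m') _ (mem_set X0).
  rewrite (_ : translate _ _ = finite_config [::]) // => /(congr1 (fun x => x m)) ->.
  by rewrite /translate opprB addrC subrK.
have [a fa] : exists a, f (finite_config [:: 0]) a.
  apply: contrapT => h; have ef : f (finite_config [:: 0]) = f (finite_config [::]).
    by apply/funext => m; rewrite f0; apply/negP => hm; apply: h; exists m.
  have := congr1 g ef; rewrite !fK ?mem_set // => /(congr1 (fun x => x 0)).
  by rewrite /finite_config mem_head in_nil.
have [W hW] := within_continuous_config a cf X1.
exists a, W => S XS sp; exists (f (finite_config S)); first exact: fXY.
move=> s sS.
(* Recentring at [s] stays in the shift, so the window [W] can be used there. *)
have XT : X (translate (- s) (finite_config S)).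
  apply: kfree_shift_intro => W'.
  have [y hy] := kfree_shift_cylinder [seq m + s | m <- W'] XS.
  exists (y + s) => m mW; rewrite /translate opprK hy; last exact: map_f.
  by rewrite -addrA [s + m]addrC.
have := feq (- s) _ (mem_set XS) => /(congr1 (fun x => x a)).
rewrite [RHS]/translate opprK addrC => <-; rewrite (hW _ XT) // => m mW.
(* By sparseness the recentred set meets [W] at most in the origin. *)
rewrite /translate /finite_config opprK inE; apply/idP/eqP => [ms|-> //].
  have e1 : m + s - s \in W by rewrite addrK.
  by have := sp _ _ sS ms e1; rewrite -{2}[s]add0r => /addIr.
by rewrite add0r.
Qed.

(* The norm form is divisible by [p] along the line [v + j (-r, 1)] for a
   suitable [v], hence its second difference [2 (r ^ 2 - t r + n)] is too. *)
Lemma avoiding_root (t n : int) (p l Q : nat) (r : int) (x : int * int) :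
  prime p -> (2 < p)%N -> ~~ (p %| Q)%N -> (0 < l)%N ->
  (forall c1 c2 : nat, (c1 < p ^ l)%N -> (c2 < p ^ l)%N ->
    ~ (p%:Z %| norm_form t n (c1%:Z, c2%:Z))%Z ->
    ~ (p%:Z ^+ l %| (x.1 + Q%:Z * c1%:Z) + (x.2 + Q%:Z * c2%:Z) * r)%Z) ->
  (p%:Z %| r ^+ 2 - t * r + n)%Z.
Proof.
move=> pp p2 pQ l0 h; set P := p%:Z ^+ l in h.
have P0 : 0 < P by rewrite exprn_gt0 // ltz_nat prime_gt0.
have pP : (p%:Z %| P)%Z by rewrite /P; case: (l) l0 => // l' _; rewrite exprS dvdz_mulr.
have cop : coprimez Q%:Z P.
  by rewrite coprimezE abszX !absz_nat coprime_sym coprimeXl // prime_coprime.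
have [u [v e]] := Bezoutz Q%:Z P; move/eqP: cop => cop; rewrite cop in e.
pose y : int * int := (- (u * x.1), - (u * x.2)).
have hmod (z : int) : exists2 c : nat, (c < p ^ l)%N & (P %| c%:Z - z)%Z.
  have z0 : 0 <= (z %% P)%Z by rewrite modz_ge0 // gt_eqF.
  exists `|(z %% P)%Z|%N; last by rewrite gez0_abs // -eqz_mod_dvd modz_mod.
  by rewrite -ltz_nat gez0_abs // PoszXn ltz_pmod.
have hj (j : int) : (p%:Z %| norm_form t n (y.1 - j * r, y.2 + j))%Z.
  have [c1 hc1 d1] := hmod (y.1 - j * r); have [c2 hc2 d2] := hmod (y.2 + j).
  have : (p%:Z %| norm_form t n (c1%:Z, c2%:Z))%Z.
    apply: contrapT => /(h _ _ hc1 hc2); apply.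
    have -> : x.1 + Q%:Z * c1%:Z + (x.2 + Q%:Z * c2%:Z) * r =
       Q%:Z * (c1%:Z - (y.1 - j * r)) + Q%:Z * r * (c2%:Z - (y.2 + j))
       - (u * Q%:Z + v * P - 1) * (x.1 + x.2 * r) + P * (v * (x.1 + x.2 * r)).
      by rewrite /y /=; ring.
    rewrite e subrr mul0r subr0.
    apply: rpredD; last exact: dvdz_mulr.
    by apply: rpredD; apply: dvdz_mull.
  by apply: norm_form_congr; split=> /=; apply: dvdz_trans pP _.
have : (p%:Z %| 2 * (r ^+ 2 - t * r + n))%Z.
  have -> : 2 * (r ^+ 2 - t * r + n) =
    (norm_form t n (y.1 - 1 * r, y.2 + 1) - norm_form t n (y.1 - 0 * r, y.2 + 0))
    + (norm_form t n (y.1 - (- 1) * r, y.2 + (- 1)) - norm_form t n (y.1 - 0 * r, y.2 + 0)).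
    by rewrite /norm_form /=; ring.
  by apply: rpredD; apply: rpredB.
case/(prime_dvdzM pp) => //; rewrite dvdzE /= => /dvdn_leq => /(_ isT).
by rewrite leqNgt p2.
Qed.

(** The prime-to-p part of [B!] supplies the small primes; the factor [2 ^ X], harmless as [p] is
    odd, supplies the size. *)
Lemma prime_complement_ex (p B X : nat) : prime p -> (2 < p)%N -> exists Q : nat,
  [/\ ~~ (p %| Q)%N, forall q, prime q -> (q <= B)%N -> q != p -> (q %| Q)%N & (X < Q)%N].
Proof.
move=> pp p2; have np2 : ~~ (p %| 2)%N.
  by apply/negP => /dvdn_leq => /(_ isT); rewrite leqNgt p2.
exists ((B`!)`_p^' * 2 ^ X)%N; split.
- rewrite Euclid_dvdM // negb_or Euclid_dvdX // (negPf np2) andbT.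
  by rewrite -p'natE // part_pnat.
- move=> q pq qB qp; apply: dvdn_mulr.
  have e : (q`_p^')%N = q.
    by rewrite part_pnat_id // p'natE // dvdn_prime2 // eq_sym.
  rewrite -{1}e; by apply: partn_dvd; [apply: fact_gt0|apply: dvdn_fact; rewrite prime_gt0].
- by apply: leq_trans (ltn_expl _ (ltnSn 1)) _; rewrite leq_pmull // part_gt0.
Qed.

(** The difference of the two polynomials is linear and vanishes modulo [p] at the distinct points
    [r] and [t' - r], so its coefficients do; being smaller than [p], they are zero. *)
Lemma common_roots (t n t' n' : int) (p : nat) (r : int) : prime p ->
  (`|(t - t')%R| < p)%N -> (`|(n - n')%R| < p)%N ->
  (p%:Z %| r ^+ 2 - t' * r + n')%Z -> ~ (p%:Z %| 2 * r - t')%Z ->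
  (p%:Z %| r ^+ 2 - t * r + n)%Z ->
  (p%:Z %| (t' - r) ^+ 2 - t * (t' - r) + n)%Z -> t = t' /\ n = n'.
Proof.
move=> pp tp np h' nr h1 h2.
have small (z : int) : (`|z| < p)%N -> (p%:Z %| z)%Z -> z = 0.
  move=> zp; rewrite dvdzE absz_nat => pz; apply/eqP; rewrite -absz_eq0.
  by apply: contraTT pz; rewrite -lt0n => z0; rewrite gtnNdvd.
have g1 : (p%:Z %| (t' - t) * r + (n - n'))%Z.
  have -> : (t' - t) * r + (n - n') = (r ^+ 2 - t * r + n) - (r ^+ 2 - t' * r + n').
    by ring.
  exact: rpredB.
have g2 : (p%:Z %| (t' - t) * (t' - r) + (n - n'))%Z.
  have -> : (t' - t) * (t' - r) + (n - n') =
    ((t' - r) ^+ 2 - t * (t' - r) + n) - (r ^+ 2 - t' * r + n') by ring.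
  exact: rpredB.
have : (p%:Z %| (t - t') * (2 * r - t'))%Z.
  have -> : (t - t') * (2 * r - t') =
    ((t' - t) * (t' - r) + (n - n')) - ((t' - t) * r + (n - n')) by ring.
  exact: rpredB.
case/(prime_dvdzM pp) => // /(small _ tp)/eqP; rewrite subr_eq0 => /eqP et.
split => //; apply/eqP; rewrite -subr_eq0; apply/eqP/small => //.
by move: g1; rewrite et subrr mul0r add0r.
Qed.

Unset Implicit Arguments.

Theorem corollary4p5 (k l : nat) (hk : (2 <= k)%N) (hl : (2 <= l)%N)
    (d e : int) (hd : real_quadratic d) (he : imaginary_quadratic e) :
  ~ topologically_conjugate (kfree_shift d k) (kfree_shift e l).
Proof.
have [hd1 d0] := hd; have [he1 e0] := he; have l0 : (0 < l)%N := ltnW hl.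
have [t [n [O dD]]] := ring_of_integers_order hd1.
have [t' [n' [O' eD]]] := ring_of_integers_order he1.
move=> /(conjugate_sparse hk l0 O O')[a [W hW]].
have [n0 D0] := gen_norm_neq0 O'.
have [p [r [pp pB pf nr]]] :=
  split_prime_ex (2 + `|(t - t')%R| + `|(n - n')%R|)%N l n0 D0.
have p2 : (2 < p)%N by apply: leq_ltn_trans pB; rewrite -addnA leq_addr.
have pt : (`|(t - t')%R| < p)%N.
  by apply: leq_ltn_trans pB; rewrite addnAC leq_addl.
have pn : (`|(n - n')%R| < p)%N by apply: leq_ltn_trans pB; rewrite leq_addl.
(* The level allows for the at most [p ^ l * p ^ l] points of [S]; exceeding all coordinates in [W]
   makes multiples of [Q] sparse. *)
have [Q [pQ hQ WQ]] := prime_complement_ex (sieve_level t n (p ^ l * p ^ l)%N)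
  (\sum_(v <- W) (`|v.1| + `|v.2|))%N pp p2.
pose I := [seq (c1, c2) | c1 <- iota 0 (p ^ l)%N, c2 <- iota 0 (p ^ l)%N].
pose good (c : nat * nat) := ~~ (p%:Z %| norm_form t n (c.1%:Z, c.2%:Z))%Z.
pose emb (c : nat * nat) : int * int := (Q%:Z * c.1%:Z, Q%:Z * c.2%:Z).
pose S := map emb (seq.filter good I).
have szS : (size S <= p ^ l * p ^ l)%N.
  rewrite size_map size_filter; apply: leq_trans (count_size _ _) _.
  by rewrite size_allpairs !size_iota.
have XS : kfree_shift d k (finite_config S).
  apply: (finite_config_kfree_shift O) => // q pq qB.
  have [->|qp] := eqVneq q p.
    (* At [p] itself the norm of a point of [S] is [Q ^+ 2] times a norm prime to [p]. *)
    exists 0 => _ /mapP[c + ->]; rewrite mem_filter => /andP[gc _] hc.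
    move/negP: gc; apply; move: hc.
    have -> : norm_form t n (0 + emb c) =
        Q%:Z * (Q%:Z * norm_form t n (c.1%:Z, c.2%:Z)).
      by rewrite /norm_form /emb /=; ring.
    have nQ : ~ (p%:Z %| Q%:Z)%Z by rewrite dvdzE; apply/negP.
    by case/(prime_dvdzM pp) => // /(prime_dvdzM pp)[].
  (* At the other small primes [S] vanishes modulo [q], so a shift by 1 makes all norms congruent to
     1. *)
  exists (1, 0) => _ /mapP[c _ ->] hc.
  have qQ : (q%:Z %| Q%:Z)%Z.
    rewrite dvdzE; apply: hQ => //; apply: leq_trans qB _.
    by rewrite /sieve_level leq_mul2l ltnS szS orbT.
  have : (q%:Z %| norm_form t n (1, 0))%Z.
    apply: norm_form_congr hc; split=> /=.
      by rewrite addrAC subrr add0r; apply: dvdz_mulr.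
    by rewrite subr0 add0r; apply: dvdz_mulr.
  have -> : norm_form t n (1, 0) = 1 by rewrite /norm_form /=; ring.
  by rewrite dvdz1 absz_nat => /eqP q1; rewrite q1 in pq.
have [|y Yy hy] := hW S XS.
  move=> _ _ /mapP[c _ ->] /mapP[c' _ ->] vW.
  have small (z : int) : (`|(Q%:Z * z)%R| < Q)%N -> z = 0.
    rewrite abszM absz_nat -[X in (_ < X)%N]muln1 ltn_mul2l ltnS leqn0 absz_eq0.
    by move=> /andP[_ /eqP].
  have [h1 h2] : (`|(emb c' - emb c)%R.1| < Q)%N /\ (`|(emb c' - emb c)%R.2| < Q)%N.
    split; apply: leq_ltn_trans WQ; rewrite (big_rem _ vW) /= -addnA ?leq_addr //.
    by rewrite addnCA leq_addr.
  move: h1 h2; rewrite /emb /= -!mulrBr => /small/eqP + /small/eqP.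
  by rewrite !subr_eq0 => /eqP -> /eqP ->.
have [z hz] := kfree_shift_cylinder [seq s + a | s <- S] Yy.
(* All of [z + a + S] is [l]-free in the second field, so it misses the prime power attached to
   [r']. *)
have avoid r' : (p%:Z ^+ l %| r' ^+ 2 - t' * r' + n')%Z ->
    ~ (p%:Z %| 2 * r' - t')%Z -> (p%:Z %| r' ^+ 2 - t * r' + n)%Z.
  move=> pf' nr'; apply: (@avoiding_root t n p l Q r' (z + a)) => // c1 c2 hc1 hc2 nc.
  have sS : emb (c1, c2) \in S.
    apply: map_f; rewrite mem_filter; apply/andP; split; first exact/negP.
    by apply/allpairsP; exists (c1, c2); rewrite /= !mem_iota.
  have := hz _ (map_f (fun s => s + a) sS); rewrite hy // => /esym/asboolP hkf h.
  apply: (lin_ideal_not_kfree O' pp pf' nr' l0) hkf.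
  move: h; rewrite /emb /=; congr (_ %| _)%Z; ring.
have pl : (p%:Z %| p%:Z ^+ l)%Z by case: (l) l0 => // l' _; rewrite exprS dvdz_mulr.
have [et en] : t = t' /\ n = n'.
  (* The conjugate root [t' - r] is simple as well and has the same value of the polynomial. *)
  apply: (common_roots pp pt pn (dvdz_trans pl pf) nr); apply: avoid => //.
    have -> : (t' - r) ^+ 2 - t' * (t' - r) + n' = r ^+ 2 - t' * r + n' by ring.
    exact: pf.
  have -> : 2 * (t' - r) - t' = - (2 * r - t') by ring.
  by rewrite rpredN.
(* The common discriminant would be positive, as [d] or [4 * d], and negative, as [e] or [4 * e]. *)
move: dD eD d0 e0; rewrite et en; move: (t' ^+ 2 - _) => D; clear; lia.
Qed.
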